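(* There is an algorithm which, given a memoryless stochastic temporal graph on an underlying graph $G=(V,E)$ with $m=|E|$ edges and probabilities $\{p_e\}$, two vertices $s,y\in V$ such that $(G,s,y)$ is a two-terminal series-parallel graph, a decomposition tree of $(G,s,y)$, and a natural number $\ell$, correctly computes the probabilities $\{\Pr[X(s,y)\geq i]: i\in[\ell]\}$ and $\{\Pr[X(s,y)=i]: i\in[\ell-1]\}$ in time $O(m\ell^2)$.
   Context: A memoryless stochastic temporal graph on $G=(V,E)$ with probabilities $\{p_e\}$ is the random sequence of snapshots $G_t=(V,E_t)$, $t=1,2,\ldots$, where each edge $e$ belongs to $E_t$ with probability $p_e$, independently over all edges and time steps. An $s$-$y$ journey is a sequence $((e_1,t_1),\ldots,(e_x,t_x))$ with $e_i\in E_{t_i}$, $(e_1,\ldots,e_x)$ a path from $s$ to $y$ in $G$, and $t_1<\cdots<t_x$; its arrival time is $t_x$. $X(s,y)$ denotes the minimum arrival time of an $s$-$y$ journey. $[\ell]=\{1,\ldots,\ell\}$. A triple $(G,s,y)$ is a two-terminal series-parallel graph if it can be built from single-edge graphs $(K_2,a,b)$ by repeated parallel composition (from $(H_1,s_1,y_1)$ and $(H_2,s_2,y_2)$ form $(G,s,y)$ by identifying $s=s_1=s_2$ and $y=y_1=y_2$) and series composition (identify $s=s_1$, $y_1=s_2$, $y=y_2$). A decomposition tree is a binary tree whose leaves are labeled by the edges of $G$ (each edge exactly once, together with an orientation bit specifying its source) and whose internal nodes are labeled p or s, such that $G$ is obtained recursively by applying parallel (resp. series) composition at each p (resp. s) node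 to the graphs of its two subtrees. *)

(* Defs.v *)
(* MathComp / MathComp-Analysis. *)
From HB Require Import structures.
From mathcomp Require Import all_boot all_order all_algebra.
From mathcomp Require Import all_classical all_reals all_analysis.

Set Implicit Arguments.
Unset Strict Implicit.
Unset Printing Implicit Defensive.

Import Order.TTheory GRing.Theory Num.Theory.

Local Open Scope nat_scope.

(** * Graphs *)

(* Parallel edges are allowed, since the parallel composition of two single
   edges already creates them; simple graphs are a special case.  An edge is
   undirected: the order of [end1] and [end2] only serves as the reference for
   the orientation bits of a decomposition tree. *)
Record graph (n m : nat) := Graph {
  end1 : 'I_m -> 'I_n;
  end2 : 'I_m -> 'I_n;
  loopless : forall e, end1 e != end2 e
}.

Definition joins n m (G : graph n m) (e : 'I_m) (u v : 'I_n) : bool :=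
  ((end1 G e == u) && (end2 G e == v)) || ((end1 G e == v) && (end2 G e == u)).

Fixpoint walk n m (G : graph n m) (u : 'I_n) (es : seq 'I_m) (vs : seq 'I_n)
    : bool :=
  match es, vs with
  | [::], [::] => true
  | e :: es', v :: vs' => joins G e u v && walk G v es' vs'
  | _, _ => false
  end.

Definition is_path n m (G : graph n m) (s y : 'I_n) (es : seq 'I_m) : Prop :=
  exists vs : seq 'I_n, [/\ walk G s es vs, uniq (s :: vs) & last s vs = y].

(** * Two-terminal series-parallel graphs *)

(* A subgraph of an ambient graph, with two terminals. *)
Record ttgraph (n m : nat) := TTGraph {
  verts : {set 'I_n};
  edges : {set 'I_m};
  source : 'I_n;
  sink : 'I_n
}.

(* [b = false]: the source is [end1]; [b = true]: the source is [end2]. *)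
Definition single_edge n m (G : graph n m) (e : 'I_m) (b : bool) : ttgraph n m :=
  TTGraph [set end1 G e; end2 G e] [set e]
    (if b then end2 G e else end1 G e) (if b then end1 G e else end2 G e).

(* All graphs live in the ambient graph, so that "identifying" terminals of two
   otherwise disjoint graphs means that the two vertex sets meet exactly in the
   identified terminals, while the edge sets are disjoint. *)
Definition is_parallel n m (H1 H2 H : ttgraph n m) : Prop :=
  [/\ source H1 = source H /\ source H2 = source H,
      sink H1 = sink H /\ sink H2 = sink H,
      verts H1 :&: verts H2 = [set source H; sink H] /\
        verts H = verts H1 :|: verts H2 &
      [disjoint edges H1 & edges H2] /\ edges H = edges H1 :|: edges H2].

Definition is_series n m (H1 H2 H : ttgraph n m) : Prop :=
  [/\ source H1 = source H /\ sink H2 = sink H,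
      sink H1 = source H2,
      verts H1 :&: verts H2 = [set sink H1] /\
        verts H = verts H1 :|: verts H2 &
      [disjoint edges H1 & edges H2] /\ edges H = edges H1 :|: edges H2].

Inductive series_parallel n m (G : graph n m) : ttgraph n m -> Prop :=
| sp_edge e b : series_parallel G (single_edge G e b)
| sp_parallel H1 H2 H :
    series_parallel G H1 -> series_parallel G H2 ->
    is_parallel H1 H2 H -> series_parallel G H
| sp_series H1 H2 H :
    series_parallel G H1 -> series_parallel G H2 ->
    is_series H1 H2 H -> series_parallel G H.

Definition whole n m (G : graph n m) (s y : 'I_n) : ttgraph n m :=
  TTGraph [set: 'I_n] [set: 'I_m] s y.

Inductive comp := Par | Ser.

Inductive sptree (m : nat) :=
| Leaf of 'I_m & bool
| Node of comp & sptree m & sptree m.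

Arguments Leaf {m} _ _.
Arguments Node {m} _ _ _.

Fixpoint builds n m (G : graph n m) (t : sptree m) (H : ttgraph n m) : Prop :=
  match t with
  | Leaf e b => H = single_edge G e b
  | Node c l r => exists H1 H2 : ttgraph n m,
      [/\ builds G l H1, builds G r H2 &
          match c with
          | Par => is_parallel H1 H2 H
          | Ser => is_series H1 H2 H
          end]
  end.

(* As compositions are edge-disjoint and all edges of [G] are reached, every
   edge labels exactly one leaf. *)
Definition decomposition_tree n m (G : graph n m) (s y : 'I_n) (t : sptree m)
    : Prop :=
  builds G t (whole G s y).

(** * Memoryless stochastic temporal graphs *)

(* [snap k] is the edge set of the [k]-th snapshot; times start at 1, and
   [snap 0] is ignored throughout. *)
Definition is_journey n m (G : graph n m) (snap : nat -> {set 'I_m})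
    (s y : 'I_n) (j : seq ('I_m * nat)) : Prop :=
  [/\ j <> [::], is_path G s y (unzip1 j), sorted ltn (unzip2 j) &
      forall et, et \in j -> 0 < et.2 /\ et.1 \in snap et.2].

Definition arrival_times n m (G : graph n m) (snap : nat -> {set 'I_m})
    (s y : 'I_n) : set nat :=
  [set a | exists2 j, is_journey G snap s y j & last 0 (unzip2 j) = a]%classic.

Section Probability.
Local Open Scope classical_set_scope.
Local Open Scope ereal_scope.

(* [+oo] when there is no journey. *)
Definition min_arrival (R : realType) n m (G : graph n m)
    (snap : nat -> {set 'I_m}) (s y : 'I_n) : \bar R :=
  ereal_inf [set (a%:R)%:E | a in arrival_times G snap s y].

Definition mutually_independent (R : realType) (d : measure_display)
    (T : measurableType d) (P : probability T R) (I : choiceType)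
    (D : set I) (A : I -> set T) : Prop :=
  forall J : seq I, uniq J -> (forall i, i \in J -> D i) ->
    P (\bigcap_(i in [set` J]) A i) = \prod_(i <- J) P (A i).

Definition edge_event m T (snap : nat -> T -> {set 'I_m}) (et : 'I_m * nat)
    : set T :=
  [set w | et.1 \in snap et.2 w].

Definition memoryless (R : realType) (d : measure_display)
    (T : measurableType d) (P : probability T R) m (p : 'I_m -> R)
    (snap : nat -> T -> {set 'I_m}) : Prop :=
  [/\ forall et, (0 < et.2)%N -> measurable (edge_event snap et),
      forall et, (0 < et.2)%N -> P (edge_event snap et) = (p et.1)%:E &
      mutually_independent P [set et | (0 < et.2)%N] (edge_event snap)].

End Probability.

(** * Real RAM *)

(* Structured programs for a unit-cost real RAM.  The memory consists of
   randomly accessible arrays of natural numbers and of exact reals; array names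
   are constants of the program text, so a program uses boundedly many arrays.
   Integers have no multiplication, division or shift, and reals have no
   rounding and no conversion to integers, which rules out the usual abuses of
   unit-cost arithmetic.  Programs contain no real constants but 0 and 1. *)
Inductive iexp :=
| ILit of nat
| IGet of nat & iexp
| IAdd of iexp & iexp
| ISub of iexp & iexp. (* truncated *)

Inductive rexp :=
| RZero
| ROne
| RGet of nat & iexp
| RAdd of rexp & rexp
| RSub of rexp & rexp
| RMul of rexp & rexp
| RDiv of rexp & rexp. (* with x / 0 = 0 *)

Inductive bexp :=
| BILe of iexp & iexp
| BRLe of rexp & rexp
| BNot of bexp
| BAnd of bexp & bexp.

Inductive cmd :=
| CSkip
| CISet of nat & iexp & iexp
| CRSet of nat & iexp & rexp
| CSeq of cmd & cmd
| CIf of bexp & cmd & cmd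
| CWhile of bexp & cmd.

Record state (R : Type) := State {
  ints : nat -> nat -> nat;
  reals : nat -> nat -> R
}.

Definition upd (X : Type) (f : nat -> nat -> X) (a i : nat) (x : X) :
    nat -> nat -> X :=
  fun a' i' => if (a' == a) && (i' == i) then x else f a' i'.

Section Semantics.
Variable R : realType.
Implicit Type st : state R.

Fixpoint ieval st (e : iexp) : nat :=
  match e with
  | ILit k => k
  | IGet a i => ints st a (ieval st i)
  | IAdd e1 e2 => ieval st e1 + ieval st e2
  | ISub e1 e2 => ieval st e1 - ieval st e2
  end.

Fixpoint reval st (e : rexp) : R :=
  (match e with
   | RZero => 0
   | ROne => 1
   | RGet a i => reals st a (ieval st i)
   | RAdd e1 e2 => reval st e1 + reval st e2
   | RSub e1 e2 => reval st e1 - reval st e2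
   | RMul e1 e2 => reval st e1 * reval st e2
   | RDiv e1 e2 => reval st e1 / reval st e2
   end)%R.

Fixpoint beval st (b : bexp) : bool :=
  match b with
  | BILe e1 e2 => ieval st e1 <= ieval st e2
  | BRLe e1 e2 => (reval st e1 <= reval st e2)%R
  | BNot b1 => ~~ beval st b1
  | BAnd b1 b2 => beval st b1 && beval st b2
  end.

Fixpoint icost (e : iexp) : nat :=
  match e with
  | ILit _ => 1
  | IGet _ i => (icost i).+1
  | IAdd e1 e2 | ISub e1 e2 => (icost e1 + icost e2).+1
  end.

Fixpoint rcost (e : rexp) : nat :=
  match e with
  | RZero | ROne => 1
  | RGet _ i => (icost i).+1
  | RAdd e1 e2 | RSub e1 e2 | RMul e1 e2 | RDiv e1 e2 =>
      (rcost e1 + rcost e2).+1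
  end.

Fixpoint bcost (b : bexp) : nat :=
  match b with
  | BILe e1 e2 => (icost e1 + icost e2).+1
  | BRLe e1 e2 => (rcost e1 + rcost e2).+1
  | BNot b1 => (bcost b1).+1
  | BAnd b1 b2 => (bcost b1 + bcost b2).+1
  end.

(* [exec c st k st']: started in [st], [c] halts in [st'] after [k] steps. *)
Inductive exec : cmd -> state R -> nat -> state R -> Prop :=
| exec_skip st : exec CSkip st 1 st
| exec_iset st a i e :
    exec (CISet a i e) st (icost i + icost e).+1
      (State (upd (ints st) a (ieval st i) (ieval st e)) (reals st))
| exec_rset st a i e :
    exec (CRSet a i e) st (icost i + rcost e).+1
      (State (ints st) (upd (reals st) a (ieval st i) (reval st e)))
| exec_seq c1 c2 st st1 st2 k1 k2 :
    exec c1 st k1 st1 -> exec c2 st1 k2 st2 ->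
    exec (CSeq c1 c2) st (k1 + k2) st2
| exec_if_true b c1 c2 st st' k :
    beval st b -> exec c1 st k st' ->
    exec (CIf b c1 c2) st (bcost b + k) st'
| exec_if_false b c1 c2 st st' k :
    ~~ beval st b -> exec c2 st k st' ->
    exec (CIf b c1 c2) st (bcost b + k) st'
| exec_while_false b c st :
    ~~ beval st b -> exec (CWhile b c) st (bcost b) st
| exec_while_true b c st st1 st2 k1 k2 :
    beval st b -> exec c st k1 st1 -> exec (CWhile b c) st1 k2 st2 ->
    exec (CWhile b c) st (bcost b + k1 + k2) st2.

End Semantics.

(** * Input and output *)

(* The nodes of the tree in preorder (node, left subtree, right subtree), each
   as a triple (kind, edge, orientation bit) with kind 0 for a leaf, 1 for p and
   2 for s; the last two entries are 0 at internal nodes. *)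
Fixpoint preorder m (t : sptree m) : seq (nat * nat * nat) :=
  match t with
  | Leaf e b => [:: (0, nat_of_ord e, nat_of_bool b)]
  | Node c l r =>
      (match c with Par => 1 | Ser => 2 end, 0, 0) :: preorder l ++ preorder r
  end.

(* Cells that hold no input are 0. *)
Definition input (R : realType) n m (G : graph n m) (p : 'I_m -> R)
    (s y : 'I_n) (t : sptree m) (l : nat) : state R :=
  let nodes := preorder t in
  State
    (fun a => match a with
      | 0 => nth 0 [:: n; m; nat_of_ord s; nat_of_ord y; l]
      | 1 => nth 0 [seq nat_of_ord (end1 G e) | e <- enum 'I_m]
      | 2 => nth 0 [seq nat_of_ord (end2 G e) | e <- enum 'I_m]
      | 3 => nth 0 [seq x.1.1 | x <- nodes]
      | 4 => nth 0 [seq x.1.2 | x <- nodes]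
      | 5 => nth 0 [seq x.2 | x <- nodes]
      | _ => fun=> 0
      end)
    (fun a => match a with
      | 0 => nth 0%R [seq p e | e <- enum 'I_m]
      | _ => fun=> 0%R
      end).

Definition out_ge (R : realType) (st : state R) (i : nat) : R := reals st 1 i.
Definition out_eq (R : realType) (st : state R) (i : nat) : R := reals st 2 i.

(* Main.v *)
(* Fix a presence pattern of the edges over time.  A simple path between the
   terminals of a series composition passes from one part to the other exactly
   once, and in a parallel composition it stays within one part; hence whether
   some journey uses only times in (a, b] is decided by a recursion over the
   decomposition tree ([reach]).  The two parts of a node have disjoint edges, so
   the corresponding events are independent.  By time homogeneity the tail
   F(d) = P(X > d) of a node depends only on the tails F1, F2 of its parts: it is
   F1(d) F2(d) for parallel composition, and for series composition summing over
   the arrival time i + 1 in the first part gives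
   1 - F(d) = sum over i < d of (F1(i) - F1(i+1)) (1 - F2(d - i - 1)).
   The program evaluates these formulas on the first l entries of the tails, on a
   stack driven by the reversed preorder, at O(l^2) steps per node. *)
Require Import Defs.
From HB Require Import structures.
From mathcomp Require Import all_boot all_order all_algebra.
From mathcomp Require Import all_classical all_reals all_analysis.
From mathcomp Require Import zify ring.

Set Implicit Arguments.
Unset Strict Implicit.
Unset Printing Implicit Defensive.

Import Order.TTheory GRing.Theory Num.Theory.

Local Open Scope nat_scope.

(** * Journeys in a series-parallel graph *)

Section Walks.
Variables (n m : nat) (G : graph n m).
Implicit Types (E : {set 'I_m}) (V : {set 'I_n}) (u v x : 'I_n).
Implicit Types (es : seq 'I_m) (vs : seq 'I_n).

Lemma walk_size u es vs : walk G u es vs -> size es = size vs.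
Proof. by elim: es u vs => [|e es IH] u [|v vs] //= /andP[_ /IH->]. Qed.

Lemma walk_cat u es1 vs1 es2 vs2 : size es1 = size vs1 ->
  walk G u (es1 ++ es2) (vs1 ++ vs2) =
  walk G u es1 vs1 && walk G (last u vs1) es2 vs2.
Proof.
by elim: es1 u vs1 => [|e es1 IH] u [|v vs1] //= [/IH->]; rewrite andbA.
Qed.

Definition ends_in E V : Prop :=
  forall e, e \in E -> end1 G e \in V /\ end2 G e \in V.

Lemma ends_in_joins E V e u v : ends_in E V -> e \in E -> joins G e u v ->
  u \in V /\ v \in V.
Proof. by move=> EV /EV[? ?] /orP[] /andP[/eqP<- /eqP<-]. Qed.

Lemma walk_verts E V u es vs : ends_in E V -> {subset es <= E} ->
  walk G u es vs -> {subset vs <= V}.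
Proof.
move=> EV; elim: es u vs => [|e es IH] u [|v vs] //= sE /andP[Je We] x.
have eE : e \in E by apply: sE; rewrite mem_head.
rewrite inE => /predU1P[->|]; first by have [] := ends_in_joins EV eE Je.
by apply: (IH v) => // e' e'es; apply: sE; rewrite inE e'es orbT.
Qed.

(* A walk can change sides only at a vertex common to both. *)
Lemma walk_one_side E1 E2 V1 V2 u e es v vs :
  ends_in E1 V1 -> ends_in E2 V2 ->
  {subset e :: es <= E1 :|: E2} -> walk G u (e :: es) (v :: vs) -> e \in E1 ->
  {in belast v vs, forall x, x \notin V1 :&: V2} -> {subset e :: es <= E1}.
Proof.
move=> EV1 EV2; elim: es u e v vs => [|e' es IH] u e v [|v' vs] //=;
  rewrite ?andbF //.
  by move=> _ _ eE1 _ x; rewrite inE => /eqP->.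
move=> sE /andP[Je We] eE1 nV x; rewrite inE => /predU1P[->//|].
apply: (IH v e' v' vs) => //.
- by move=> z zes; apply: sE; rewrite inE zes orbT.
- have e'E : e' \in E1 :|: E2 by apply: sE; rewrite !inE eqxx orbT.
  have Je' : joins G e' v v' by case/andP: We.
  move: e'E; rewrite inE => /orP[//|e'E2].
  have := nV v (mem_head _ _); rewrite inE.
  by rewrite (ends_in_joins EV1 eE1 Je).2 (ends_in_joins EV2 e'E2 Je').1.
- by move=> z zvs; apply: nV; rewrite inE zvs orbT.
Qed.

(** Unlike in [is_path], the vertex list is exposed, so that a path can be cut at one of its
    vertices. *)
Definition path_in E u v es vs : Prop :=
  [/\ walk G u es vs, uniq (u :: vs), last u vs = v & {subset es <= E}].

End Walks.

(** * Paths in parallel and series compositions *)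

Fixpoint leaves m (t : sptree m) : seq 'I_m :=
  match t with
  | Leaf e _ => [:: e]
  | Node _ t1 t2 => leaves t1 ++ leaves t2
  end.

Section Builds.
Variables (n m : nat) (G : graph n m).
Implicit Types (t : sptree m) (H : ttgraph n m).

(** Invariants of both compositions; distinct terminals rule out the empty path. *)
Record well_formed H : Prop := WellFormed {
  wf_source : source H \in verts H;
  wf_sink : sink H \in verts H;
  wf_neq : source H != sink H;
  wf_ends : ends_in G (edges H) (verts H)
}.

Lemma ends_inU (E1 E2 : {set 'I_m}) (V1 V2 : {set 'I_n}) :
  ends_in G E1 V1 -> ends_in G E2 V2 -> ends_in G (E1 :|: E2) (V1 :|: V2).
Proof.
by move=> EV1 EV2 e; rewrite !inE => /orP[/EV1|/EV2] [-> ->]; rewrite ?orbT.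
Qed.

(** Looplessness separates the terminals of a leaf. In a series node, equal terminals would lie in
    both vertex sets, so the source would be the middle vertex, against distinctness in the first
    part. *)
Lemma builds_wf t H : builds G t H -> well_formed H.
Proof.
elim: t H => [e b|[] t1 IH1 t2 IH2] H /=.
- move=> ->; split; rewrite /= ?inE; try by case: b; rewrite eqxx ?orbT.
    by case: b => /=; rewrite ?loopless // eq_sym loopless.
  by move=> e'; rewrite !inE => /eqP->; rewrite !eqxx orbT.
- move=> [H1 [H2 [/IH1 W1 /IH2 W2 [[s1 s2] [y1 y2] [VI VU] [_ EU]]]]].
  split.
  + by rewrite VU inE -s1 wf_source.
  + by rewrite VU inE -y1 wf_sink.
  + by rewrite -s1 -y1 wf_neq.
  + by rewrite VU EU; apply: ends_inU; apply: wf_ends.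
- move=> [H1 [H2 [/IH1 W1 /IH2 W2 [[s1 y2] z [VI VU] [_ EU]]]]].
  split.
  + by rewrite VU inE -s1 wf_source.
  + by rewrite VU inE -y2 (wf_sink W2) orbT.
  + apply/eqP => sy; have : source H1 \in verts H1 :&: verts H2.
      by rewrite inE (wf_source W1) s1 sy -y2 (wf_sink W2).
    by rewrite VI inE (negPf (wf_neq W1)).
  + by rewrite VU EU; apply: ends_inU; apply: wf_ends.
Qed.

Lemma builds_leaves t H : builds G t H -> edges H =i leaves t /\ uniq (leaves t).
Proof.
elim: t H => [e b|c t1 IH1 t2 IH2] H /=.
  by move=> ->; split=> // e'; rewrite /= !inE.
move=> [H1 [H2 [/IH1[E1 U1] /IH2[E2 U2] cH]]].
have [dis EU] : [disjoint edges H1 & edges H2] /\ edges H = edges H1 :|: edges H2.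
  by case: c cH => [] [].
split; first by move=> e; rewrite EU inE mem_cat E1 E2.
rewrite cat_uniq U1 U2 andbT; apply/hasPn => e; rewrite -E2 /= => e2.
by rewrite -E1 (disjointFl dis e2).
Qed.

(** This ties the size of the tree to [m] and, through distinct labels, makes the events of sibling
    subtrees independent. *)
Lemma decomposition_tree_leaves s y t : decomposition_tree G s y t ->
  perm_eq (leaves t) (enum 'I_m).
Proof.
move=> /builds_leaves[EH U]; apply: uniq_perm; rewrite ?enum_uniq // => e.
by rewrite -EH mem_enum !inE.
Qed.

(** A second use of [e] would lead back to a visited vertex. *)
Lemma path_in_leaf e b es vs :
  let H := single_edge G e b in
  path_in G (edges H) (source H) (sink H) es vs <->
  es = [:: e] /\ vs = [:: sink H].
Proof.
set H := single_edge G e b; have ne : source H != sink H.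
  by apply: (wf_neq (@builds_wf (Leaf e b) H erefl)).
have J : joins G e (source H) (sink H).
  by rewrite /joins /H; case: b {H ne} => /=; rewrite !eqxx ?orbT.
split=> [[W U L sE]|[-> ->]]; last first.
  by split=> //= [||x]; rewrite ?J ?inE ?ne.
case: es vs W U L sE => [|e1 es] [|v vs] //=; first by move=> _ _ /eqP; rewrite (negPf ne).
move=> /andP[J1 W] U L sE.
have ee x : x \in e1 :: es -> x = e by move=> /sE; rewrite inE => /eqP.
have e1e := ee e1 (mem_head _ _); subst e1.
case: es vs W U L sE ee => [|e2 es] [|v2 vs] //=; first by move=> _ _ ->.
move=> /andP[J2 _] U _ _ ee; have e2e : e2 = e by apply: ee; rewrite !inE eqxx orbT.
subst e2; move: U; rewrite /= !inE !negb_or => /andP[/and3P[sv sv2 _]] /andP[/andP[vv2 _] _].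
move: J1 J2; rewrite /joins => /orP[] /andP[/eqP E1 /eqP E2] /orP[] /andP[/eqP F1 /eqP F2];
  by move: sv sv2 vv2; rewrite -?E1 -?E2 -?F1 -?F2 ?eqxx.
Qed.

Lemma sub_path_in (E E' : {set 'I_m}) u v es vs :
  {subset E <= E'} -> path_in G E u v es vs -> path_in G E' u v es vs.
Proof. by move=> sub [? ? ? sE]; split=> // e /sE /sub. Qed.

(** The only candidates for a crossing are the start [u], which a path never revisits, and [z],
    which may occur only at the very end. *)
Lemma path_in_one_side H1 H2 e es v vs u z :
  well_formed H1 -> well_formed H2 ->
  walk G u (e :: es) (v :: vs) ->
  {subset e :: es <= edges H1 :|: edges H2} -> e \in edges H1 ->
  {subset verts H1 :&: verts H2 <= [:: u; z]} ->
  uniq (u :: v :: vs) -> z \notin belast v vs ->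
  {subset e :: es <= edges H1}.
Proof.
move=> W1 W2 W sE e1 sV U nz.
apply: (walk_one_side (wf_ends W1) (wf_ends W2) sE W e1) => x xvs.
apply/negP => /sV; rewrite !inE => /orP[] /eqP xE; subst x; last by rewrite xvs in nz.
by move: U; rewrite cons_uniq (mem_belast xvs).
Qed.

Lemma uniq_last_belast (v : 'I_n) vs : uniq (v :: vs) -> last v vs \notin belast v vs.
Proof. by rewrite lastI rcons_uniq => /andP[]. Qed.

(** The part holding the first edge holds all of them, since the other common vertex, the sink, is
    met only at the end. *)
Lemma path_in_par H1 H2 H es vs :
  well_formed H1 -> well_formed H2 -> is_parallel H1 H2 H ->
  path_in G (edges H) (source H) (sink H) es vs <->
  path_in G (edges H1) (source H1) (sink H1) es vs \/
  path_in G (edges H2) (source H2) (sink H2) es vs.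
Proof.
move=> W1 W2 [[s1 ->] [y1 ->] [VI _] [_ EU]]; rewrite s1 y1.
split; last first.
  by case; apply: sub_path_in => e; rewrite EU inE => ->; rewrite ?orbT.
move=> [W U L sE]; case: es vs W U L sE => [|e es] [|v vs] //.
  by move=> _ _ /= /eqP sy; have := wf_neq W1; rewrite s1 y1 sy.
move=> W U L sE; rewrite EU in sE.
have nz : sink H \notin belast v vs.
  by rewrite -L; apply: uniq_last_belast; move: U => /andP[].
have sV : {subset verts H1 :&: verts H2 <= [:: source H; sink H]}.
  by move=> x; rewrite VI !inE.
have := sE e (mem_head _ _); rewrite inE => /orP[eE|eE]; [left|right]; split=> //.
- exact: (path_in_one_side W1 W2 W sE eE sV U nz).
- rewrite finset.setUC in sE; rewrite finset.setIC in sV.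
  exact: (path_in_one_side W2 W1 W sE eE sV U nz).
Qed.

(** A path must start in the first part, because its source is not a vertex of the second, and it
    has to leave through the middle vertex [sink H1]; it is cut there. *)
Lemma path_in_ser H1 H2 H es vs :
  well_formed H1 -> well_formed H2 -> is_series H1 H2 H ->
  path_in G (edges H) (source H) (sink H) es vs <->
  exists es1 vs1 es2 vs2, [/\ es = es1 ++ es2, vs = vs1 ++ vs2,
    path_in G (edges H1) (source H1) (sink H1) es1 vs1 &
    path_in G (edges H2) (source H2) (sink H2) es2 vs2].
Proof.
move=> W1 W2 [[s1 y2] z [VI _] [_ EU]]; rewrite -s1 -y2.
have ny1 : sink H2 \notin verts H1.
  apply/negP => y1; have : sink H2 \in verts H1 :&: verts H2 by rewrite inE y1 wf_sink.
  by rewrite VI inE z eq_sym (negPf (wf_neq W2)).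
have ns2 : source H1 \notin verts H2.
  apply/negP => s2; have : source H1 \in verts H1 :&: verts H2 by rewrite inE s2 wf_source.
  by rewrite VI inE (negPf (wf_neq W1)).
split; last first.
  move=> [es1 [vs1 [es2 [vs2 [-> -> [Wa U1 L1 sE1] [Wb U2 L2 sE2]]]]]].
  have sz := walk_size Wa.
  split.
  - by rewrite walk_cat // Wa L1 z.
  (* A vertex on both halves would be the middle vertex, which the second half visits only at its
     start. *)
  - rewrite -cat_cons cat_uniq U1; move: U2 => /= /andP[zn2 ->]; rewrite andbT /=.
    apply/hasPn => x x2 /=; apply/negP => x1.
    have xV1 : x \in verts H1.
      move: x1; rewrite inE => /predU1P[->|]; first exact: wf_source.
      by apply: (walk_verts (wf_ends W1) sE1 Wa).
    have xV2 := walk_verts (wf_ends W2) sE2 Wb x2.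
    have : x \in verts H1 :&: verts H2 by rewrite inE xV1.
    by rewrite VI inE z => /eqP xz; rewrite -xz x2 in zn2.
  - by rewrite last_cat L1 z.
  - by move=> e; rewrite mem_cat EU inE => /orP[/sE1->|/sE2->]; rewrite ?orbT.
move=> [W U L sE]; rewrite EU in sE.
have sV : {subset verts H1 :&: verts H2 <= [:: source H1; sink H1]}.
  by move=> x; rewrite VI !inE => ->; rewrite orbT.
have first1 e es' v vs' : walk G (source H1) (e :: es') (v :: vs') ->
    e \in edges H1 :|: edges H2 -> e \in edges H1.
  rewrite inE => /andP[Je _] /orP[//|e2].
  by move: ns2; rewrite (ends_in_joins (wf_ends W2) e2 Je).1.
(* A path avoiding the middle vertex would stay in the first part and could not end at [sink H2]. *)
have zvs : sink H1 \in vs.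
  apply/negPn/negP => nz.
  case: es vs W U L sE nz => [|e es] [|v vs] //.
    by move=> _ _ /= sy _ _; move: ny1; rewrite -sy wf_source.
  move=> W U L sE nz.
  have eE := first1 _ _ _ _ W (sE e (mem_head _ _)).
  have nz' : sink H1 \notin belast v vs by apply: contra nz => /mem_belast.
  have sE1 := path_in_one_side W1 W2 W sE eE sV U nz'.
  have := walk_verts (wf_ends W1) sE1 W (mem_last v vs).
  by move: L => /= ->; rewrite (negPf ny1).
case/splitPr: zvs W U L => vs1 vs2 W U L.
rewrite -cat_rcons in W U L *.
set k := size (rcons vs1 (sink H1)).
have szes : size es = (k + size vs2)%N by rewrite (walk_size W) size_cat.
have sk : size (take k es) = k by rewrite size_takel // szes leq_addr.
exists (take k es), (rcons vs1 (sink H1)), (drop k es), vs2.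
rewrite -[es in walk G _ es](cat_take_drop k) walk_cat // in W.
move/andP: W => [Wa Wb]; rewrite last_rcons in Wb.
rewrite last_cat last_rcons in L.
rewrite -cat_cons cat_uniq in U; move/and3P: U => [U1 nU U2].
have zn2 : sink H1 \notin vs2.
  by move/hasPn: nU => nU; apply/negP => /nU; rewrite /= inE mem_rcons mem_head orbT.
have sEt : {subset take k es <= edges H1 :|: edges H2} by move=> e /mem_take /sE.
have sEd : {subset drop k es <= edges H1 :|: edges H2} by move=> e /mem_drop /sE.
rewrite cat_take_drop; split=> //.
- split; rewrite ?last_rcons //.
  case: (take k es) (rcons vs1 _) (last_rcons (source H1) vs1 (sink H1)) Wa U1 sEt
    => [|e es1] [|v vs1'] //.
  move=> Lz Wa U1 sEt; apply: (path_in_one_side W1 W2 Wa sEt _ sV U1).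
    exact: (first1 _ _ _ _ Wa (sEt e (mem_head _ _))).
  by rewrite -Lz; apply: uniq_last_belast; case/andP: U1.
- rewrite -z; split=> //; first by rewrite /= zn2.
  case: (drop k es) vs2 Wb U2 L zn2 sEd {szes nU} => [|e es2] [|v vs2] //.
  move=> Wb U2 L zn2 sEd.
  have nz : sink H1 \notin belast v vs2 by apply: contra zn2 => /mem_belast.
  have U2' : uniq (sink H1 :: v :: vs2) by rewrite cons_uniq zn2.
  (* The middle vertex is the start of this half and the only common vertex, so it also serves as
     [z]. If the half began in the first part, it would stay there and miss [sink H2]. *)
  have sVz : {subset verts H1 :&: verts H2 <= [:: sink H1; sink H1]}.
    by move=> x; rewrite VI !inE => ->.
  have := sEd e (mem_head _ _); rewrite inE => /orP[e1|e2].
    have sE1 := path_in_one_side W1 W2 Wb sEd e1 sVz U2' nz.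
    have := walk_verts (wf_ends W1) sE1 Wb (mem_last v vs2).
    by move: L => /= ->; rewrite (negPf ny1).
  rewrite finset.setUC in sEd; rewrite finset.setIC in sVz.
  exact: (path_in_one_side W2 W1 Wb sEd e2 sVz U2' nz).
Qed.

End Builds.

(** * Reachability within a time window *)

Section Reach.
Variables (n m : nat) (G : graph n m).
Implicit Types (c : 'I_m * nat -> bool) (j : seq ('I_m * nat)).

(* Some journey from source to sink uses only times in (a, b]; [c (e, k)] tells
   whether [e] is present at time [k]. *)
Fixpoint reach (t : sptree m) c (a b : nat) : bool :=
  match t with
  | Leaf e _ => has (fun k => c (e, k)) (index_iota a.+1 b.+1)
  | Node Par t1 t2 => reach t1 c a b || reach t2 c a b
  | Node Ser t1 t2 =>
      has (fun k => reach t1 c a k && reach t2 c k b) (index_iota a.+1 b.+1)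
  end.

Definition timed c (a b : nat) j : bool :=
  [&& path ltn a (unzip2 j), last a (unzip2 j) <= b & all c j].

Lemma path_ltn_last a ks : path ltn a ks -> a <= last a ks.
Proof.
by elim: ks a => //= k ks IH a /andP[ak /IH]; apply: leq_trans; apply: ltnW.
Qed.

Lemma path_ltn_last_lt a ks : ks != [::] -> path ltn a ks -> a < last a ks.
Proof.
by case: ks => //= k ks _ /andP[ak /path_ltn_last]; apply: leq_trans.
Qed.

Lemma timed_cat c a b j1 j2 :
  timed c a b (j1 ++ j2) <->
  timed c a (last a (unzip2 j1)) j1 /\ timed c (last a (unzip2 j1)) b j2.
Proof.
rewrite /timed /unzip2 map_cat cat_path last_cat all_cat leqnn /=.
split=> [/and3P[/andP[-> ->] -> /andP[-> ->]]//|[/andP[-> ->] /and3P[-> -> ->]]//].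
Qed.

Lemma timedW c a a' b b' j : a' <= a -> b <= b' -> timed c a b j -> j <> [::] ->
  timed c a' b' j.
Proof.
rewrite /timed; case: j => [//|[e k] j] a'a bb' /= /and3P[/andP[ak ->] L ->] _.
by rewrite (leq_ltn_trans a'a ak) (leq_trans L bb').
Qed.

Lemma path_in_neq0 (E : {set 'I_m}) (u v : 'I_n) j vs : u != v ->
  path_in G E u v (unzip1 j) vs -> j != [::].
Proof.
move=> uv [W _ L _]; case: j vs W L => [|x j] [|w vs] //= _ /eqP.
by rewrite (negPf uv).
Qed.

Lemma reachP t H c a b : builds G t H ->
  reach t c a b <->
  exists j vs, path_in G (edges H) (source H) (sink H) (unzip1 j) vs
               /\ timed c a b j.
Proof.
elim: t H a b => [e bt|[] t1 IH1 t2 IH2] H a b /=.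
- move=> ->; split.
    move=> /hasP[k]; rewrite mem_index_iota ltnS => /andP[ak kb] ck.
    exists [:: (e, k)], [:: sink (single_edge G e bt)].
    by split; [apply/path_in_leaf | rewrite /timed /= ak kb ck].
  move=> [j [vs [/path_in_leaf[ej _] /and3P[]]]].
  case: j ej => [|[e' k] [|? ?]] //= -[->]; rewrite !andbT => ak kb ck.
  by apply/hasP; exists k; rewrite // mem_index_iota ltnS ak.
- move=> [H1 [H2 [B1 B2 cH]]].
  have PH := path_in_par _ _ (builds_wf B1) (builds_wf B2) cH.
  split.
    by case/orP => [/(IH1 _ _ _ B1)|/(IH2 _ _ _ B2)] [j [vs [Pj Tj]]];
      exists j, vs; split=> //; apply/PH; [left|right].
  move=> [j [vs [/PH[Pj|Pj] Tj]]]; apply/orP; [left|right].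
    by apply/(IH1 _ _ _ B1); exists j, vs.
  by apply/(IH2 _ _ _ B2); exists j, vs.
- move=> [H1 [H2 [B1 B2 cH]]].
  have W1 := builds_wf B1; have W2 := builds_wf B2.
  have PH := path_in_ser _ _ W1 W2 cH.
  split.
    move=> /hasP[k]; rewrite mem_index_iota ltnS => /andP[ak kb].
    move=> /andP[/(IH1 _ _ _ B1)[j1 [vs1 [P1 T1]]] /(IH2 _ _ _ B2)[j2 [vs2 [P2 T2]]]].
    exists (j1 ++ j2), (vs1 ++ vs2); split.
      by apply/PH; exists (unzip1 j1), vs1, (unzip1 j2), vs2; rewrite /unzip1 map_cat.
    apply/timed_cat; split; first by case/and3P: T1 => p1 _ c1; rewrite /timed p1 leqnn.
    (* The first part may arrive before [k]; the window of the second is widened down to that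
       arrival. *)
    apply: (timedW _ (leqnn b) T2); first by case/and3P: T1.
    by apply/eqP/(path_in_neq0 (wf_neq W2) P2).
  move=> [j [vs [/PH[es1 [vs1 [es2 [vs2 [Ej _ P1 P2]]]]] Tj]]].
  pose j1 := take (size es1) j; pose j2 := drop (size es1) j.
  have E1 : unzip1 j1 = es1.
    by rewrite /unzip1 map_take -/(unzip1 j) Ej take_size_cat.
  have E2 : unzip1 j2 = es2.
    by rewrite /unzip1 map_drop -/(unzip1 j) Ej drop_size_cat.
  rewrite -E1 in P1; rewrite -E2 in P2.
  move: Tj; rewrite -(cat_take_drop (size es1) j) -/j1 -/j2 => /timed_cat[T1 T2].
  have n1 := path_in_neq0 (wf_neq W1) P1.
  apply/hasP; exists (last a (unzip2 j1)).
    rewrite mem_index_iota ltnS; apply/andP; split.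
      apply: path_ltn_last_lt; first by case: (j1) n1.
      by case/and3P: T1.
    by case/and3P: T2 => /path_ltn_last le1 le2 _; apply: leq_trans le2.
  by rewrite (IH1 _ _ _ B1).2 ?(IH2 _ _ _ B2).2 //; [exists j2, vs2 | exists j1, vs1].
Qed.

(** At the root with [a = 0], the strict lower bound of the window is the positivity of times. *)
Lemma arrival_reach s y t (snap : nat -> {set 'I_m}) b :
  decomposition_tree G s y t ->
  reach t (fun et => et.1 \in snap et.2) 0 b <->
  exists2 a, arrival_times G snap s y a & a <= b.
Proof.
move=> D; have /= W := builds_wf D; split.
  move=> /(reachP _ _ _ D)[j [vs /= [Pj Tj]]].
  have n0 : j <> [::] by apply/eqP/(path_in_neq0 (wf_neq W) Pj).
  case: Pj Tj => Wj Uj Lj _ /and3P[Pj Lb /allP Aj].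
  exists (last 0 (unzip2 j)) => //; exists j => //; split=> //.
  - by exists vs.
  - by move: Pj; case: (unzip2 j) => //= k ks /andP[].
  - move=> et etj; split; last exact: Aj.
    have : et.2 \in unzip2 j by apply: map_f.
    by have := order_path_min ltn_trans Pj => /allP/[apply].
move=> [a [j [j0 [vs [Wj Uj Lj]] Sj Aj] La] ab]; apply/(reachP _ _ _ D).
exists j, vs; split; first by split=> // e; rewrite !inE.
apply/and3P; split; last 2 first.
- by rewrite La.
- by apply/allP => et /Aj[].
case: j j0 Sj Aj {Wj La} => // et j _ /= -> Aj.
by rewrite andbT; have [] := Aj et (mem_head _ _).
Qed.

End Reach.

Local Open Scope classical_set_scope.
Local Open Scope nat_scope.

(** * Independence *)

Section Independence.
Context (R : realType) (d : measure_display) (T : measurableType d).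
Variable (P : probability T R).
Implicit Types (Q S B : T -> bool).

Definition event Q : Prop := measurable [set w | Q w].
Definition pr Q : R := fine (P [set w | Q w]).

Lemma eq_event Q S : Q =1 S -> event Q -> event S.
Proof. by move=> /funext ->. Qed.

Lemma eq_pr Q S : Q =1 S -> pr Q = pr S.
Proof. by move=> /funext ->. Qed.

Lemma prE Q : event Q -> P [set w | Q w] = (pr Q)%:E.
Proof. by move=> mQ; rewrite /pr fineK // fin_num_measure. Qed.

Lemma event_cst b : event (fun=> b).
Proof.
rewrite /event; case: b; first by rewrite (_ : mkset _ = setT) //; apply/seteqP.
by rewrite (_ : mkset _ = set0) //; apply/seteqP; split.
Qed.

Lemma eventN Q : event Q -> event (fun w => ~~ Q w).
Proof.
move=> mQ; rewrite /event (_ : mkset _ = ~` [set w | Q w]); first exact: measurableC.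
by apply/seteqP; split=> w /= /negP.
Qed.

Lemma eventI Q S : event Q -> event S -> event (fun w => Q w && S w).
Proof.
move=> mQ mS; rewrite /event (_ : mkset _ = [set w | Q w] `&` [set w | S w]).
  exact: measurableI.
by apply/seteqP; split=> w /= /andP.
Qed.

Lemma eventU Q S : event Q -> event S -> event (fun w => Q w || S w).
Proof.
move=> mQ mS; apply: (eq_event _ (eventN (eventI (eventN mQ) (eventN mS)))).
by move=> w; rewrite negb_and !negbK.
Qed.

Lemma pr_true : pr xpredT = 1%R.
Proof.
rewrite /pr (_ : mkset _ = setT) ?probability_setT //.
by apply/seteqP.
Qed.

Lemma pr_false : pr xpred0 = 0%R.
Proof.
rewrite /pr (_ : mkset _ = set0) ?measure0 //.
by apply/seteqP; split.
Qed.

Lemma pr_split Q S : event Q -> event S ->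
  pr Q = (pr (fun w => Q w && S w) + pr (fun w => Q w && ~~ S w))%R.
Proof.
move=> mQ mS; apply: EFin_inj; rewrite EFinD -!prE //; last 2 first.
- exact: eventI (eventN mS).
- exact: eventI.
rewrite -measureU; [|exact: eventI|exact: eventI (eventN mS)|].
  congr (P _); apply/seteqP; split=> w /=; first by case: (S w) => ->; [left|right].
  by case=> /andP[].
by apply/seteqP; split=> w //= -[/andP[_ ->]] /andP[].
Qed.

Lemma prN Q : event Q -> pr (fun w => ~~ Q w) = (1 - pr Q)%R.
Proof. by move=> mQ; rewrite -pr_true (pr_split (event_cst true) mQ) /=; ring. Qed.

Lemma pr_has (K : eqType) (E : K -> T -> bool) (s : seq K) :
  uniq s -> (forall k, k \in s -> event (E k)) ->
  (forall k k' w, k \in s -> k' \in s -> E k w -> E k' w -> k = k') ->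
  pr (fun w => has (E^~ w) s) = (\sum_(k <- s) pr (E k))%R.
Proof.
elim: s => [|k s IH] /=; first by rewrite big_nil => *; exact: pr_false.
move=> /andP[ks us] mE ex.
have mEs k' : k' \in s -> event (E k') by move=> k's; apply: mE; rewrite inE k's orbT.
have mEk : event (E k) by apply: mE; rewrite mem_head.
have mH : event (fun w => has (E^~ w) s).
  elim: s mEs {IH ks us mE ex} => [|k' s IH] mEs; first exact: event_cst.
  apply: (eventU (mEs k' (mem_head _ _))); apply: IH => k'' k''s.
  by apply: mEs; rewrite inE k''s orbT.
rewrite big_cons -IH //; last first.
  by move=> k1 k2 w k1s k2s; apply: ex; rewrite inE ?k1s ?k2s orbT.
rewrite (pr_split (eventU mEk mH) mEk); congr (_ + _)%R; apply: eq_pr => w /=.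
  by case: (E k w); rewrite ?andbF.
case Ek: (E k w); rewrite /= ?andbF ?andbT //; apply/esym/negbTE/hasPn => k' k's.
apply/negP => Ek'; move: ks; rewrite (ex k k' w) ?k's ?mem_head //.
by rewrite inE k's orbT.
Qed.

(** * Events determined by finitely many independent coordinates *)

Section Family.
Variables (I : eqType) (D : pred I) (A : I -> T -> bool).
Hypothesis mA : forall i, D i -> event (A i).
Hypothesis indA : forall J, uniq J -> all D J ->
  pr (fun w => all (A^~ w) J) = (\prod_(i <- J) pr (A i))%R.
Implicit Types (f g : (I -> bool) -> bool) (J K L : seq I).

(** A combinatorial substitute for measurability with respect to the sigma-algebra generated by the
    coordinates in [J]. *)
Definition depends_on J f : Prop :=
  forall c c' : I -> bool, {in J, c =1 c'} -> f c = f c'.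

Lemma depends_onN J f : depends_on J f -> depends_on J (fun c => ~~ f c).
Proof. by move=> dJ c c' /dJ->. Qed.

Lemma depends_onI J f g :
  depends_on J f -> depends_on J g -> depends_on J (fun c => f c && g c).
Proof. by move=> df dg c c' cc'; rewrite (df _ _ cc') (dg _ _ cc'). Qed.

Definition assign i b (c : I -> bool) : I -> bool :=
  fun k => if k == i then b else c k.

(** Fixing a coordinate removes it from the support, which drives the inductions on [J]. *)
Lemma depends_on_assign i b J f :
  depends_on (i :: J) f -> depends_on J (f \o assign i b).
Proof.
move=> df c c' cc'; apply: df => k; rewrite /assign inE; case: eqP => //= _.
exact: cc'.
Qed.

Lemma assign_id i c : assign i (c i) c = c.
Proof. by apply/funext => k; rewrite /assign; case: eqP => [->|]. Qed.

(** Shannon expansion of [f] along the coordinates of [J]. *)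
Lemma event_depends J f : all D J -> depends_on J f -> event (fun w => f (A^~ w)).
Proof.
elim: J f => [|i J IH] f /=.
  move=> _ df; apply: (eq_event _ (event_cst (f xpred0))) => w.
  exact: df.
move=> /andP[Di DJ] df.
have m b : event (fun w => f (assign i b (A^~ w))).
  exact: (IH _ DJ (depends_on_assign b df)).
apply: (eq_event _ (eventU (eventI (mA Di) (m true)) (eventI (eventN (mA Di)) (m false)))).
move=> w; have := assign_id i (A^~ w).
by case: (A i w) => /= ->; rewrite ?orbF.
Qed.

Lemma event_all J : all D J -> event (fun w => all (A^~ w) J).
Proof.
move=> DJ; apply: (@event_depends J (fun c => all c J)) => // c c' cc'.
exact: eq_in_all.
Qed.

(* Inclusion-exclusion on [A i] leaves only intersections with [A i] itself, to
   which the product rule applies. *)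
Lemma pr_cond B i J f : event B -> D i -> all D J -> depends_on (i :: J) f ->
  (pr (fun w => B w && f (A^~ w)) =
   pr (fun w => (B w && A i w) && f (assign i true (A^~ w)))
   + pr (fun w => B w && f (assign i false (A^~ w)))
   - pr (fun w => (B w && A i w) && f (assign i false (A^~ w))))%R.
Proof.
move=> mB Di DJ df.
have mf : event (fun w => f (A^~ w)) by apply: event_depends df => /=; rewrite Di.
have m b : event (fun w => f (assign i b (A^~ w))).
  exact: (event_depends DJ (depends_on_assign b df)).
rewrite (pr_split (eventI mB mf) (mA Di)) (pr_split (eventI mB (m false)) (mA Di)).
rewrite [X in (_ = _ + (X + _) - _)%R]
  (_ : _ = pr (fun w => B w && A i w && f (assign i false (A^~ w)))); last first.
  by apply: eq_pr => w; rewrite andbAC.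
rewrite [X in (X + _ = _)%R]
  (_ : _ = pr (fun w => B w && A i w && f (assign i true (A^~ w)))); last first.
  apply: eq_pr => w; have := assign_id i (A^~ w).
  by case: (A i w) => [->|_]; rewrite ?andbT ?andbF.
rewrite [X in (_ + X = _)%R]
  (_ : _ = pr (fun w => (B w && f (assign i false (A^~ w))) && ~~ A i w)); last first.
  apply: eq_pr => w; have := assign_id i (A^~ w).
  by case: (A i w) => [_|->]; rewrite ?andbT ?andbF.
ring.
Qed.

(** Induction on [J]: [pr_cond] removes a coordinate from [f], at the price of terms where it joins
    the list [L] of events required to hold. Once [f] is constant, the product hypothesis
    applies. *)
Lemma pr_indep_family B J L f : event B ->
  (forall M, uniq M -> {subset M <= L ++ J} ->
     pr (fun w => B w && all (A^~ w) M) = (pr B * pr (fun w => all (A^~ w) M))%R) ->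
  all D J -> all D L -> uniq (L ++ J) -> depends_on J f ->
  pr (fun w => (B w && all (A^~ w) L) && f (A^~ w)) =
  (pr B * pr (fun w => all (A^~ w) L && f (A^~ w)))%R.
Proof.
move=> mB; elim: J L f => [|i J IH] L f indB DJ DL U df.
  have fE w : f (A^~ w) = f xpred0 by apply: df.
  case fb: (f xpred0) fE => fE.
    rewrite -(_ : pr (fun w => B w && all (A^~ w) L) = pr _); last first.
      by apply: eq_pr => w; rewrite fE andbT.
    rewrite indB //; last 2 first.
    - by rewrite cats0 in U.
    - by rewrite cats0.
    by congr (_ * _)%R; apply: eq_pr => w; rewrite fE andbT.
  rewrite -(_ : pr xpred0 = pr _); last by apply: eq_pr => w; rewrite fE andbF.
  rewrite -(_ : pr xpred0 = pr (fun w => _ && f _)); last by apply: eq_pr => w; rewrite fE andbF.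
  by rewrite pr_false mulr0.
case/andP: DJ => Di DJ.
have P1 : perm_eq ((i :: L) ++ J) (L ++ i :: J).
  by rewrite perm_sym; apply/permPl/(perm_catCA L [:: i] J).
have U1 : uniq ((i :: L) ++ J) by rewrite (perm_uniq P1).
have DL1 : all D (i :: L) by rewrite /= Di.
have indB1 M : uniq M -> {subset M <= (i :: L) ++ J} ->
    pr (fun w => B w && all (A^~ w) M) = (pr B * pr (fun w => all (A^~ w) M))%R.
  by move=> uM sM; apply: indB => // k /sM; rewrite (perm_mem P1).
have U0 : uniq (L ++ J) by move: U1 => /= /andP[].
have indB0 M : uniq M -> {subset M <= L ++ J} ->
    pr (fun w => B w && all (A^~ w) M) = (pr B * pr (fun w => all (A^~ w) M))%R.
  by move=> uM sM; apply: indB1 => // k /sM kM; rewrite inE kM orbT.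
have mL := event_all DL.
rewrite (pr_cond (eventI mB mL) Di DJ df) (pr_cond mL Di DJ df).
have E1 b : pr (fun w => ((B w && all (A^~ w) L) && A i w) && f (assign i b (A^~ w))) =
    (pr B * pr (fun w => (all (A^~ w) L && A i w) && f (assign i b (A^~ w))))%R.
  have /= IHb := IH (i :: L) _ indB1 DJ DL1 U1 (depends_on_assign b df).
  transitivity (pr (fun w => (B w && (A i w && all (A^~ w) L)) &&
                             f (assign i b (A^~ w)))).
    by apply: eq_pr => w; rewrite [A i w && _]andbC andbA.
  by rewrite IHb; congr (_ * _)%R; apply: eq_pr => w; rewrite [A i w && all _ _]andbC.
rewrite !E1 (IH L _ indB0 DJ DL U0 (depends_on_assign false df)) /=; ring.
Qed.

(** [pr_indep_family] is used twice: first with an intersection of coordinates of [K] as the fixed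
    event, to free it from [f], then with [f] as the fixed event, to reach [g]. *)
Lemma pr_indep J K f g : uniq (J ++ K) -> all D (J ++ K) ->
  depends_on J f -> depends_on K g ->
  pr (fun w => f (A^~ w) && g (A^~ w)) =
  (pr (fun w => f (A^~ w)) * pr (fun w => g (A^~ w)))%R.
Proof.
move=> U; rewrite all_cat => /andP[DJ DK] df dg.
move: (U); rewrite cat_uniq => /and3P[UJ UJK UK].
have mf := event_depends DJ df.
have indall M N : uniq M -> uniq N -> {subset M <= J} -> {subset N <= K} ->
    pr (fun w => all (A^~ w) N && all (A^~ w) M) =
    (pr (fun w => all (A^~ w) N) * pr (fun w => all (A^~ w) M))%R.
  move=> uM uN sM sN.
  have DM : all D M by apply/allP => i /sM; apply/allP.
  have DN : all D N by apply/allP => i /sN; apply/allP.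
  rewrite (@eq_pr _ (fun w => all (A^~ w) (N ++ M))); last by move=> w; rewrite all_cat.
  rewrite !indA ?all_cat ?DM ?DN ?big_cat // cat_uniq uM uN andbT /=.
  apply/hasPn => i /sM iJ /=; apply/negP => /sN iK.
  by move/hasPn: UJK => /(_ i iK) /=; rewrite iJ.
have indf N : uniq N -> {subset N <= K} ->
    pr (fun w => f (A^~ w) && all (A^~ w) N) =
    (pr (fun w => f (A^~ w)) * pr (fun w => all (A^~ w) N))%R.
  rewrite mulrC => uN sN; have DN : all D N by apply/allP => i /sN; apply/allP.
  have /= <- := pr_indep_family (L := [::]) (event_all DN) _ DJ isT UJ df.
    by apply: eq_pr => w; rewrite andbT andbC.
  by move=> M uM sM; apply: indall.
have /= <- := pr_indep_family (L := [::]) mf indf DK isT UK dg.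
by apply: eq_pr => w; rewrite andbT.
Qed.

End Family.
End Independence.

(** * Arrival probabilities *)

Section Tail.
Context (R : realType).
Local Open Scope ring_scope.
Implicit Types (F : nat -> R).

(* Tails are the functions [k |-> P(X > k)]. *)
Definition leaf_tail (q : R) (k : nat) : R := (1 - q) ^+ k.
Definition par_tail F1 F2 (k : nat) : R := F1 k * F2 k.
Definition ser_tail F1 F2 (k : nat) : R :=
  1 - \sum_(0 <= i < k) (F1 i - F1 i.+1) * (1 - F2 (k - i.+1)%N).

Fixpoint tail m (p : 'I_m -> R) (t : sptree m) : nat -> R :=
  match t with
  | Leaf e _ => leaf_tail (p e)
  | Node Par t1 t2 => par_tail (tail p t1) (tail p t2)
  | Node Ser t1 t2 => ser_tail (tail p t1) (tail p t2)
  end.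

End Tail.

(** * Probability of crossing a subgraph in a time window *)

Section ReachProbability.
Context (R : realType) (d : measure_display) (T : measurableType d).
Variables (P : probability T R) (m : nat) (p : 'I_m -> R).
Variable snap : nat -> T -> {set 'I_m}.
Hypothesis ml : memoryless P p snap.

Let A (et : 'I_m * nat) (w : T) : bool := et.1 \in snap et.2 w.
Let D (et : 'I_m * nat) : bool := 0 < et.2.

Lemma memoryless_event et : D et -> event (A et).
Proof. by case: ml => mA _ _ /mA. Qed.

Lemma memoryless_pr et : D et -> pr P (A et) = p et.1.
Proof. by case: ml => _ pA _ /pA H; rewrite /pr /= -/(edge_event snap et) H. Qed.

Lemma memoryless_indep J : uniq J -> all D J ->
  pr P (fun w => all (A^~ w) J) = (\prod_(et <- J) pr P (A et))%R.
Proof.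
case: ml => mA pA indA uJ DJ; apply: EFin_inj.
have -> : ((\prod_(et <- J) pr P (A et))%R)%:E = (\prod_(et <- J) P (edge_event snap et))%E.
  elim: J DJ {uJ} => [|et J IH] /=; first by rewrite !big_nil.
  by move=> /andP[Det /IH IHJ]; rewrite !big_cons EFinM IHJ -prE //; apply: memoryless_event.
rewrite -indA //; last by move=> et /(allP DJ).
rewrite -prE; last by apply: event_all (memoryless_event) _ DJ.
congr (P _); apply/seteqP; split=> w /=; first by move=> /allP al et /al.
by move=> al; apply/allP => et /al.
Qed.

(** The coordinates on which reachability of [t] in the window (a, b] depends. *)
Definition slots (t : sptree m) a b : seq ('I_m * nat) :=
  [seq (e, k) | e <- leaves t, k <- index_iota a.+1 b.+1].

Lemma mem_slots t a b e k :
  ((e, k) \in slots t a b) = (e \in leaves t) && (a < k <= b).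
Proof.
apply/allpairsP/andP => [[[e' k'] /= [et kab [-> ->]]]|[et kab]].
  by move: kab; rewrite mem_index_iota ltnS.
by exists (e, k); rewrite /= mem_index_iota ltnS.
Qed.

Lemma all_slots t a b : all D (slots t a b).
Proof. by apply/allP => -[e k]; rewrite mem_slots => /and3P[_ ak _]; apply: leq_trans ak. Qed.

Lemma uniq_slots t a b : uniq (leaves t) -> uniq (slots t a b).
Proof. by move=> ut; apply: allpairs_uniq; rewrite ?iota_uniq // => -[? ?] [? ?] _ _ [-> ->]. Qed.

Lemma uniq_slots_cat t1 t2 a b : uniq (leaves t1 ++ leaves t2) ->
  uniq (slots t1 a b ++ slots t2 a b).
Proof.
rewrite !cat_uniq => /and3P[u1 /hasPn nu u2]; rewrite !uniq_slots //= andbT.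
apply/hasPn => -[e k]; rewrite /= !mem_slots => /andP[/nu /negPf -> _].
exact: negbT.
Qed.

Lemma reach_mono (t : sptree m) c a a' b b' : a' <= a -> b <= b' ->
  reach t c a b -> reach t c a' b'.
Proof.
elim: t a a' b b' => [e bt|[] t1 IH1 t2 IH2] a a' b b' a'a bb' /=.
- move=> /hasP[k]; rewrite mem_index_iota ltnS => /andP[ak kb] ck.
  apply/hasP; exists k => //; rewrite mem_index_iota ltnS.
  by rewrite (leq_ltn_trans a'a ak) (leq_trans kb bb').
- by case/orP => [/(IH1 _ _ _ _ a'a bb')|/(IH2 _ _ _ _ a'a bb')] ->; rewrite ?orbT.
- move=> /hasP[k]; rewrite mem_index_iota ltnS => /andP[ak kb] /andP[r1 r2].
  apply/hasP; exists k; last by rewrite (IH1 _ _ _ _ a'a _ r1) ?(IH2 _ _ _ _ _ bb' r2).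
  by rewrite mem_index_iota ltnS (leq_ltn_trans a'a ak) (leq_trans kb bb').
Qed.

Lemma reach_empty (t : sptree m) c a : reach t c a a = false.
Proof. by elim: t => [e bt|[] t1 IH1 t2 IH2] /=; rewrite ?IH1 ?IH2 // /index_iota subnn. Qed.

(** The support may exceed the window, so that both parts of a series node can be supported on the
    window of the node. *)
Lemma depends_on_reach t a b a' b' : a' <= a -> b <= b' ->
  depends_on (slots t a' b') (fun c => reach t c a b).
Proof.
elim: t a b a' b' => [e bt|cp t1 IH1 t2 IH2] a b a' b' a'a bb' c c' cc' /=.
  apply: eq_in_has => k; rewrite mem_index_iota ltnS => /andP[ak kb].
  by apply: cc'; rewrite mem_slots /= mem_head (leq_ltn_trans a'a ak) (leq_trans kb bb').
have cc1 : {in slots t1 a' b', c =1 c'}.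
  by move=> [e k]; rewrite mem_slots => /andP[et kab]; apply: cc'; rewrite mem_slots mem_cat et.
have cc2 : {in slots t2 a' b', c =1 c'}.
  move=> [e k]; rewrite mem_slots => /andP[et kab]; apply: cc'.
  by rewrite mem_slots mem_cat et orbT.
case: cp {cc'}; first by rewrite (IH1 _ _ _ _ a'a bb' _ _ cc1) (IH2 _ _ _ _ a'a bb' _ _ cc2).
apply: eq_in_has => k; rewrite mem_index_iota ltnS => /andP[ak kb].
rewrite (IH1 _ _ _ _ a'a (leq_trans kb bb') _ _ cc1).
by rewrite (IH2 _ _ _ _ (leq_trans a'a (ltnW ak)) bb' _ _ cc2).
Qed.

Definition reached t a b (w : T) : bool := reach t (A^~ w) a b.

Lemma event_reached t a b : event (reached t a b).
Proof.
exact: (event_depends memoryless_event (all_slots t a b)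
  (@depends_on_reach t a b a b _ _)).
Qed.

(* Splitting by the time of the first crossing makes the cases disjoint. *)
Lemma reach_ser_first (t1 t2 : sptree m) c a b :
  reach (Node Ser t1 t2) c a b =
  has (fun k => (reach t1 c a k && ~~ reach t1 c a k.-1) && reach t2 c k b)
    (index_iota a.+1 b.+1).
Proof.
rewrite /=; apply/hasP/hasP => [[k]|[k kab]]; last first.
  by move=> /andP[/andP[r1 _] r2]; exists k; rewrite ?r1.
rewrite mem_index_iota ltnS => /andP[ak kb] /andP[r1 r2].
have ex : exists k, reach t1 c a k by exists k.
case: (ex_minnP ex) => k0 rk0 mink0.
have k0k := mink0 _ r1.
have ak0 : a < k0.
  rewrite ltnNge; apply/negP => k0a.
  by have := reach_mono (leqnn a) k0a rk0; rewrite reach_empty.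
exists k0; first by rewrite mem_index_iota ltnS ak0 (leq_trans k0k kb).
rewrite rk0 (reach_mono k0k (leqnn b) r2) andbT; apply/negP => /mink0; lia.
Qed.

(** The right side ignores [a]: this is time homogeneity. The induction needs every [a], because the
    window of the second part of a series node starts at the crossing time. *)
Lemma pr_reached t a k : uniq (leaves t) ->
  pr P (fun w => ~~ reached t a (a + k) w) = tail p t k.
Proof.
elim: t a k => [e bt|[] t1 IH1 t2 IH2] a k /=.
- move=> _; rewrite /leaf_tail; elim: k => [|k IH].
    rewrite expr0 -(pr_true P); apply: eq_pr => w.
    by rewrite /reached /= /index_iota addn0 subnn.
  (* The last slot is split off; it is independent of the earlier ones and contributes the factor
     [1 - p e]. *)
  rewrite exprSr -IH -(@memoryless_pr (e, a + k.+1)); last by rewrite /D /=; lia.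
  rewrite -prN; last by apply: memoryless_event; rewrite /D /=; lia.
  rewrite -(@pr_indep _ _ _ P _ D A memoryless_event memoryless_indep
    (slots (Leaf e bt) a (a + k)) [:: (e, a + k.+1)]
    (fun c => ~~ reach (Leaf e bt) c a (a + k)) (fun c => ~~ c (e, a + k.+1))).
  + apply: eq_pr => w; rewrite /reached /= /index_iota.
    have -> : (a + k.+1).+1 - a.+1 = ((a + k).+1 - a.+1) + 1 by lia.
    rewrite iotaD has_cat /= orbF negb_or.
    by have -> : a.+1 + ((a + k).+1 - a.+1) = a + k.+1 by lia.
  + rewrite cat_uniq uniq_slots //= mem_slots orbF andbT.
    apply/negP; lia.
  + by rewrite all_cat all_slots /= /D /= andbT; lia.
  + exact/depends_onN/depends_on_reach.
  + by move=> c c' cc'; rewrite cc' // mem_head.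
- move=> U; have [U1 U2] : uniq (leaves t1) /\ uniq (leaves t2).
    by move: U; rewrite cat_uniq => /and3P[-> _ ->].
  rewrite /par_tail -(IH1 a) // -(IH2 a) // -(@pr_indep _ _ _ P _ D A
    memoryless_event memoryless_indep (slots t1 a (a + k)) (slots t2 a (a + k))
    (fun c => ~~ reach t1 c a (a + k)) (fun c => ~~ reach t2 c a (a + k))).
  + by apply: eq_pr => w; rewrite /reached /= negb_or.
  + exact: uniq_slots_cat.
  + by rewrite all_cat !all_slots.
  + exact/depends_onN/depends_on_reach.
  + exact/depends_onN/depends_on_reach.
- move=> U; have [U1 U2] : uniq (leaves t1) /\ uniq (leaves t2).
    by move: U; rewrite cat_uniq => /and3P[-> _ ->].
  rewrite prN; last exact: event_reached.
  rewrite /ser_tail; congr (1 - _)%R.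
  have -> : pr P (reached (Node Ser t1 t2) a (a + k)) =
    pr P (fun w => has (fun i => (reached t1 a i w && ~~ reached t1 a i.-1 w) &&
       reached t2 i (a + k) w) (index_iota a.+1 (a + k).+1)).
    by apply: eq_pr => w; rewrite /reached reach_ser_first.
  rewrite (@pr_has _ _ _ P _ (fun i w => (reached t1 a i w && ~~ reached t1 a i.-1 w) &&
       reached t2 i (a + k) w)); first last.
  + move=> i i' w; rewrite !mem_index_iota => /andP[ai _] /andP[ai' _].
    move=> /andP[/andP[r1 /negP n1] _] /andP[/andP[r1' /negP n1'] _].
    have [lt|lt|//] := ltngtP i i'.
      by case: n1'; apply: reach_mono r1 => //; lia.
    by case: n1; apply: reach_mono r1' => //; lia.
  + move=> i _; apply: eventI; last exact: event_reached.
    by apply: eventI; [|apply: eventN]; apply: event_reached.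
  + exact: iota_uniq.
  (* The crossing time becomes [i + a.+1], so that [i] is the summation index of [ser_tail]. *)
  rewrite -[a.+1]addn0 -[in X in index_iota _ X]addSn addnC [(a.+1 + k)%N]addnC.
  rewrite big_addn addnK; apply: eq_big_nat => i /andP[_ ik].
  have mono : reached t1 a (i + a.+1).-1 =1
     (fun w => reached t1 a (i + a.+1) w && reached t1 a (i + a.+1).-1 w).
    move=> w; case r: (reached t1 a (i + a.+1).-1 w); rewrite ?andbF // andbT.
    by apply/esym; apply: reach_mono r => //; lia.
  rewrite (@pr_indep _ _ _ P _ D A
    memoryless_event memoryless_indep (slots t1 a (a + k)) (slots t2 a (a + k))
    (fun c => reach t1 c a (i + a.+1) && ~~ reach t1 c a (i + a.+1).-1)
    (fun c => reach t2 c (i + a.+1) (a + k))).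
  (* By monotonicity, first arrival exactly at [i + a.+1] has probability F1(i) - F1(i+1); the
     second part is left a window of length k - (i+1). *)
  + congr (_ * _)%R.
      rewrite -(IH1 a) // -(IH1 a i.+1) // !prN; try exact: event_reached.
      have := pr_split P (event_reached t1 a (i + a.+1)) (event_reached t1 a (i + a.+1).-1).
      rewrite -(eq_pr _ mono).
      have -> : (i + a.+1).-1 = a + i by lia.
      have -> : i + a.+1 = a + i.+1 by lia.
      rewrite /reached => ->; ring.
    rewrite -(IH2 (i + a.+1)) // prN; last exact: event_reached.
    have -> : i + a.+1 + (k - i.+1) = a + k by lia.
    rewrite /reached; ring.
  + exact: uniq_slots_cat.
  + by rewrite all_cat !all_slots.
  + by apply: depends_onI; [|apply: depends_onN]; apply: depends_on_reach => //; lia.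
  + by apply: depends_on_reach => //; lia.
Qed.

End ReachProbability.

(** * The program *)

Lemma upd_lt (X : Type) (f : nat -> nat -> X) a b i x k :
  a < b -> upd f b i x a k = f a k.
Proof. by rewrite /upd; case: eqP => //= ->; rewrite ltnn. Qed.

(** * Time-bounded correctness of programs *)

Section Run.
Variable R : realType.
Implicit Types (st : state R) (Q : state R -> Prop) (c : cmd).

(** Total correctness with a time budget. Nesting [run] in the postcondition chains commands. *)
Definition run c st (K : nat) Q : Prop :=
  exists k st', [/\ exec c st k st', k <= K & Q st'].

Lemma run_le c st K' K Q : run c st K' Q -> K' <= K -> run c st K Q.
Proof.
move=> [k [st' [e kK' q]]] K'K; exists k, st'; split=> //; exact: leq_trans K'K.
Qed.

Lemma run_iset a i e st Q :
  Q (State (upd (ints st) a (ieval st i) (ieval st e)) (reals st)) ->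
  run (CISet a i e) st (icost i + icost e).+1 Q.
Proof. by move=> q; do 2 eexists; split; [exact: exec_iset|exact: leqnn|]. Qed.

Lemma run_rset a i e st Q :
  Q (State (ints st) (upd (reals st) a (ieval st i) (reval st e))) ->
  run (CRSet a i e) st (icost i + rcost e).+1 Q.
Proof. by move=> q; do 2 eexists; split; [exact: exec_rset|exact: leqnn|]. Qed.

Lemma run_seq c1 c2 st K1 K2 Q :
  run c1 st K1 (fun st1 => run c2 st1 K2 Q) -> run (CSeq c1 c2) st (K1 + K2) Q.
Proof.
move=> [k1 [st1 [e1 le1 [k2 [st2 [e2 le2 q]]]]]].
by exists (k1 + k2), st2; split; [exact: exec_seq e1 e2|exact: leq_add|].
Qed.

Lemma run_post c st K Q Q' : run c st K Q' -> (forall st', Q' st' -> Q st') ->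
  run c st K Q.
Proof. by move=> [k [st' [e le q]]] QQ; exists k, st'; split=> //; apply: QQ. Qed.

(** Charging both branches avoids a maximum and is harmless for asymptotic bounds. *)
Lemma run_if b c1 c2 st K1 K2 Q :
  (beval st b -> run c1 st K1 Q) -> (~~ beval st b -> run c2 st K2 Q) ->
  run (CIf b c1 c2) st (bcost b + (K1 + K2)) Q.
Proof.
move=> t f; case bv: (beval st b).
  have [k [st' [e le q]]] := t bv; exists (bcost b + k), st'.
  by split=> //; [exact: exec_if_true|rewrite leq_add2l (leq_trans le) ?leq_addr].
have [k [st' [e le q]]] := f (negbT bv); exists (bcost b + k), st'.
by split=> //; [apply: exec_if_false; rewrite ?bv|rewrite leq_add2l (leq_trans le) ?leq_addl].
Qed.

Lemma run_while_end b c st Q : ~~ beval st b -> Q st -> run (CWhile b c) st (bcost b) Q.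
Proof. by move=> bv q; exists (bcost b), st; split=> //; apply: exec_while_false. Qed.

Lemma run_while_step b c st K1 K2 Q : beval st b ->
  run c st K1 (fun st1 => run (CWhile b c) st1 K2 Q) ->
  run (CWhile b c) st (bcost b + K1 + K2) Q.
Proof.
move=> bv [k1 [st1 [e1 le1 [k2 [st2 [e2 le2 q]]]]]].
exists (bcost b + k1 + k2), st2; split=> //; first exact: exec_while_true e2.
by rewrite leq_add // leq_add2l.
Qed.

Lemma run_for b c (Inv : nat -> state R -> Prop) N K st :
  (forall i st1, i < N -> Inv i st1 -> beval st1 b /\ run c st1 K (Inv i.+1)) ->
  (forall st1, Inv N st1 -> ~~ beval st1 b) -> Inv 0 st ->
  run (CWhile b c) st (N * (bcost b + K) + bcost b) (Inv N).
Proof.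
move=> step stop inv0.
suff gen j i st1 : i + j = N -> Inv i st1 ->
    run (CWhile b c) st1 (j * (bcost b + K) + bcost b) (Inv N).
  exact: (gen N 0).
elim: j i st1 => [|j IH] i st1.
  by rewrite addn0 => -> inv; apply: run_while_end => //; apply: stop.
move=> ijN inv; have [bv rc] : beval st1 b /\ run c st1 K (Inv i.+1).
  by apply: step => //; rewrite -ijN; lia.
rewrite mulSn -addnA; apply: run_while_step => //; apply: (run_post rc) => st2.
by apply: IH; rewrite -ijN; lia.
Qed.

End Run.

(* Integer array 6 holds the registers: cell 0 the number of nodes still to be
   processed, cell 1 the height of the stack kept in real array 3, cells 2 and 3
   loop counters.  Real array 4 holds an accumulator. *)
Definition reg k := IGet 6 (ILit k).
Definition set_reg k e := CISet 6 (ILit k) e.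
Definition len := IGet 0 (ILit 4).
Definition acc := RGet 4 (ILit 0).
Definition set_acc e := CRSet 4 (ILit 0) e.
Definition incr k := set_reg k (IAdd (reg k) (ILit 1)).
Definition reg_lt k e := BILe (IAdd (reg k) (ILit 1)) e.

Definition leaf_cmd : cmd :=
  CSeq (set_acc ROne) (CSeq (set_reg 2 (ILit 0)) (CSeq
    (CWhile (reg_lt 2 len)
      (CSeq (CRSet 3 (IAdd (reg 1) (reg 2)) acc) (CSeq
        (set_acc (RMul acc (RSub ROne (RGet 0 (IGet 4 (reg 0))))))
        (incr 2))))
    (set_reg 1 (IAdd (reg 1) len)))).

(** These addresses presuppose that [reg 1] was already lowered by one block: the left tail,
    computed last, starts at [reg 1], and the right tail lies in the block below, which receives the
    result. *)
Definition fst_cell i := IAdd (reg 1) i.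
Definition snd_cell i := IAdd (ISub (reg 1) len) i.

Definition par_cmd : cmd :=
  CSeq (set_reg 2 (ILit 0))
    (CWhile (reg_lt 2 len)
      (CSeq (CRSet 3 (snd_cell (reg 2))
               (RMul (RGet 3 (fst_cell (reg 2))) (RGet 3 (snd_cell (reg 2)))))
        (incr 2))).

(* In place and descending: entry [k] of the result overwrites entry [k] of the
   second argument, which is needed only for the entries above [k]. *)
Definition ser_cmd : cmd :=
  CSeq (set_reg 2 len)
    (CWhile (BILe (ILit 1) (reg 2))
      (CSeq (set_reg 2 (ISub (reg 2) (ILit 1))) (CSeq (set_acc ROne) (CSeq
        (set_reg 3 (ILit 0)) (CSeq
        (CWhile (reg_lt 3 (reg 2))
          (CSeq
            (set_acc (RSub acc
              (RMul (RSub (RGet 3 (fst_cell (reg 3)))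
                          (RGet 3 (fst_cell (IAdd (reg 3) (ILit 1)))))
                    (RSub ROne
                      (RGet 3 (snd_cell (ISub (reg 2) (IAdd (reg 3) (ILit 1)))))))))
            (incr 3)))
        (CRSet 3 (snd_cell (reg 2)) acc)))))).

Definition body_cmd : cmd :=
  CSeq (set_reg 0 (ISub (reg 0) (ILit 1)))
    (CIf (BILe (IGet 3 (reg 0)) (ILit 0)) leaf_cmd
      (CSeq (set_reg 1 (ISub (reg 1) len))
        (CIf (BILe (IGet 3 (reg 0)) (ILit 1)) par_cmd ser_cmd))).

Definition loop_cmd : cmd := CWhile (BILe (ILit 1) (reg 0)) body_cmd.

(** Since P(X >= i) = F(i-1), the first output is shifted by one. At counter 0 the truncated
    subtraction stores F(0) - F(0) in a cell outside the output range. *)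
Definition output_cmd : cmd :=
  CSeq (set_reg 2 (ILit 0))
    (CWhile (reg_lt 2 len)
      (CSeq (CRSet 1 (IAdd (reg 2) (ILit 1)) (RGet 3 (reg 2))) (CSeq
        (CRSet 2 (reg 2) (RSub (RGet 3 (ISub (reg 2) (ILit 1))) (RGet 3 (reg 2))))
        (incr 2)))).

(** The initial counter is 2m - 1, the number of nodes of a binary tree with m leaves. *)
Definition sp_program : cmd :=
  CSeq (set_reg 0 (ISub (IAdd (IGet 0 (ILit 1)) (IGet 0 (ILit 1))) (ILit 1)))
    (CSeq loop_cmd output_cmd).

(** * Correctness and cost of processing one node *)

Section Correctness.
Variable R : realType.
Variable st0 : state R.
Implicit Types (st : state R) (F : nat -> R).

Let l := ints st0 0 4.

Record regs (q b : nat) st : Prop := Regs {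
  regs_ints : forall a k, a < 6 -> ints st a k = ints st0 a k;
  regs_reals : forall k, reals st 0 k = reals st0 0 k;
  regs_node : ints st 6 0 = q;
  regs_height : ints st 6 1 = b
}.

Lemma regs_len q b st : regs q b st -> ints st 0 4 = l.
Proof. by move=> r; rewrite (regs_ints r). Qed.

Lemma regs_iset q b st k x : 1 < k -> regs q b st ->
  regs q b (State (upd (ints st) 6 k x) (reals st)).
Proof.
move=> k1 [ri rr r0 r1]; split=> //=.
- by move=> a i a6; rewrite upd_lt // ri.
- by rewrite /upd; case: k k1.
- by rewrite /upd; case: k k1 => // -[].
Qed.

Lemma regs_rset q b st a i x : 0 < a -> regs q b st ->
  regs q b (State (ints st) (upd (reals st) a i x)).
Proof. by move=> a0 [ri rr r0 r1]; split=> //= k; rewrite upd_lt // rr. Qed.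

(** The unchanged cells are recorded too, which preserves the tails lower on the stack. *)
Definition wrote b F i j (mem mem' : nat -> R) : Prop :=
  forall x, mem' x = if b + i <= x < b + j then F (x - b) else mem x.

Lemma run_leaf q b st : regs q b st ->
  run leaf_cmd st (40 * l + 40) (fun st' => regs q (b + l) st' /\
    wrote b (leaf_tail (reals st0 0 (ints st0 4 q))) 0 l (reals st 3) (reals st' 3)).
Proof.
move=> rg; set pe := reals st0 0 _.
pose Inv i st' := [/\ regs q b st', ints st' 6 2 = i, reals st' 4 0 = leaf_tail pe i &
  wrote b (leaf_tail pe) 0 i (reals st 3) (reals st' 3)].
apply: run_le; first apply: run_seq; first apply: run_rset.
  apply: run_seq; apply: run_iset; apply: run_seq.
  apply: (@run_post _ _ _ _ _ (Inv l)); first apply: (@run_for _ _ _ Inv).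
  - move=> i st1 il [rg1 r2 ac wr]; split; first by rewrite /= r2 (regs_len rg1) addn1.
    apply: run_seq; apply: run_rset; apply: run_seq; apply: run_rset; apply: run_iset.
    split.
    + by apply: regs_iset => //; apply: regs_rset => //; apply: regs_rset.
    + by rewrite /= /upd /= r2 addn1.
    + rewrite /= /upd /= ac (regs_node rg1) (regs_ints rg1) // (regs_reals rg1).
      by rewrite /leaf_tail exprSr.
    + move=> x; rewrite /= /upd /= r2 (regs_height rg1) ac wr.
      have [->|ne] := eqVneq x (b + i).
        by rewrite ifT ?addKn //; lia.
      by congr (if _ then _ else _); lia.
  - by move=> st1 [rg1 r2 _ _]; rewrite /= r2 (regs_len rg1); lia.
  - split; [by apply: regs_iset => //; apply: regs_rset|by []| |].
    + by rewrite /leaf_tail expr0.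
    + by move=> x; rewrite ifF //; lia.
  move=> st1 [rg1 r2 _ wr]; apply: run_iset; split=> //.
  rewrite /= (regs_height rg1) (regs_len rg1).
  case: rg1 => ri rr r0 r1; split=> //= a k a6.
  by rewrite upd_lt // ri.
by rewrite /=; lia.
Qed.

Lemma run_par q b st F1 F2 : regs q (b + l) st ->
  (forall k, k < l -> reals st 3 (b + l + k) = F1 k) ->
  (forall k, k < l -> reals st 3 (b + k) = F2 k) ->
  run par_cmd st (40 * l + 40) (fun st' => regs q (b + l) st' /\
    wrote b (par_tail F1 F2) 0 l (reals st 3) (reals st' 3)).
Proof.
move=> rg f1 f2.
pose Inv i st' := [/\ regs q (b + l) st', ints st' 6 2 = i &
  wrote b (par_tail F1 F2) 0 i (reals st 3) (reals st' 3)].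
apply: run_le; first apply: run_seq; first apply: run_iset.
  apply: (@run_post _ _ _ _ _ (Inv l)); first apply: (@run_for _ _ _ Inv).
  - move=> i st1 il [rg1 r2 wr]; split; first by rewrite /= r2 (regs_len rg1) addn1.
    apply: run_seq; apply: run_rset; apply: run_iset.
    split.
    + by apply: regs_iset => //; apply: regs_rset.
    + by rewrite /= /upd /= r2 addn1.
    + move=> x; rewrite /= /upd /= r2 (regs_height rg1) (regs_len rg1) addnK !wr.
      have [->|ne] := eqVneq x (b + i).
        (* Both operands are still intact: one lies in the upper block, the other is the cell about
           to be overwritten. *)
        rewrite [in RHS]ifT; last by lia.
        rewrite ifF; last by lia.
        by rewrite ifF; [rewrite f1 // f2 // addKn|lia].
      by congr (if _ then _ else _); lia.
  - by move=> st1 [rg1 r2 _]; rewrite /= r2 (regs_len rg1); lia.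
  - split; [exact: regs_iset|by []|].
    by move=> x; rewrite ifF //; lia.
  by move=> st1 [rg1 _ wr].
by rewrite /=; lia.
Qed.

Lemma run_ser q b st F1 F2 : regs q (b + l) st ->
  (forall k, k < l -> reals st 3 (b + l + k) = F1 k) ->
  (forall k, k < l -> reals st 3 (b + k) = F2 k) ->
  run ser_cmd st (100 * l ^ 2 + 100 * l + 40) (fun st' => regs q (b + l) st' /\
    wrote b (ser_tail F1 F2) 0 l (reals st 3) (reals st' 3)).
Proof.
move=> rg f1 f2.
pose Inv i st' := [/\ regs q (b + l) st', ints st' 6 2 = l - i &
  wrote b (ser_tail F1 F2) (l - i) l (reals st 3) (reals st' 3)].
apply: run_le; first apply: run_seq; first apply: run_iset.
  apply: (@run_post _ _ _ _ _ (Inv l)).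
    (* One round computes one entry, with an inner loop of fewer than [l] iterations of constant
       cost. *)
    apply: (@run_for _ _ _ Inv l (90 * l + 80)).
    - move=> i st1 il [rg1 r2 wr]; split; first by rewrite /= r2; lia.
      pose k := l - i.+1.
      have kl : k < l by rewrite /k; lia.
      pose Inv' j st' := [/\ regs q (b + l) st', ints st' 6 2 = k, ints st' 6 3 = j,
        reals st' 3 =1 reals st1 3 &
        reals st' 4 0 = (1 - \sum_(0 <= i < j) (F1 i - F1 i.+1) * (1 - F2 (k - i.+1)%N))%R].
      apply: run_le; first apply: run_seq; first apply: run_iset.
        apply: run_seq; apply: run_rset; apply: run_seq; apply: run_iset.
        apply: run_seq; apply: (@run_post _ _ _ _ _ (Inv' k)).
          apply: (@run_for _ _ _ Inv').
          + move=> j st2 jk [rg2 s2 s3 mem ac].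
            split; first by rewrite /= s2 s3 addn1.
            apply: run_seq; apply: run_rset; apply: run_iset; split.
            * by apply: regs_iset => //; apply: regs_rset.
            * by rewrite /= /upd /= s2.
            * by rewrite /= /upd /= s3 addn1.
            * by move=> x; rewrite /= /upd /= mem.
            rewrite /= /upd /= ac s2 s3 (regs_height rg2) (regs_len rg2) addnK !mem !wr.
            (* No cell read here has been overwritten: those of the first part start at [b + l],
               those of the second have index below [k]. *)
            rewrite !ifF; try by rewrite /k in jk *; lia.
            rewrite addn1 !f1 ?f2; try by rewrite /k in jk *; lia.
            by rewrite big_nat_recr //= opprD addrA.
          + by move=> st2 [rg2 s2 s3 _ _]; rewrite /= s2 s3; lia.
          + split.
            * by do 2 (apply: regs_iset => //; try apply: regs_rset => //).
            * by rewrite /= /upd /= r2 /k; lia.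
            * by [].
            * by [].
            * by rewrite big_geq // subr0.
        move=> st2 [rg2 s2 s3 mem ac]; apply: run_rset; split.
        + exact: regs_rset.
        + by rewrite /= s2.
        + move=> x; rewrite /= /upd /= s2 (regs_height rg2) (regs_len rg2) addnK.
          rewrite ac mem wr.
          have [->|ne] := eqVneq x (b + k).
            by rewrite ifT ?addKn //; rewrite /k; lia.
          by congr (if _ then _ else _); rewrite /k in ne *; lia.
      by rewrite /=; rewrite /k; nia.
    - by move=> st1 [rg1 r2 _]; rewrite /= r2 subnn.
    - split; first exact: regs_iset.
        by rewrite /= /upd /= (regs_len rg) subn0.
      by move=> x; rewrite ifF //; lia.
  by move=> st1 [rg1 _ wr]; rewrite subnn in wr.
by rewrite /=; nia.
Qed.

(** The head of [S] is the top of the stack; each tail is stored by its first [l] values only. *)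
Fixpoint stacked (mem : nat -> R) (S : seq (nat -> R)) : Prop :=
  match S with
  | [::] => True
  | F :: S' => (forall k, k < l -> mem (size S' * l + k) = F k) /\ stacked mem S'
  end.

Lemma eq_stacked mem mem' S : (forall x, x < size S * l -> mem x = mem' x) ->
  stacked mem S -> stacked mem' S.
Proof.
elim: S => //= F S IH eqm [mF /IH mS]; split.
  by move=> k kl; rewrite -eqm ?mF // mulSn; lia.
by apply: mS => x xS; apply: eqm; rewrite mulSn; lia.
Qed.

Lemma stacked_wrote mem mem' S F F' : stacked mem S ->
  wrote (size S * l) F 0 l mem mem' -> (forall k, k < l -> F k = F' k) ->
  stacked mem' (F' :: S).
Proof.
move=> st wr FF; split.
  by move=> k kl; rewrite wr ifT ?addKn ?FF //; lia.
by apply: eq_stacked st => x xS; rewrite wr ifF //; lia.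
Qed.

(** One bound for all node kinds; the quadratic term is due to series nodes. *)
Definition body_bound := 200 * l ^ 2 + 300 * l + 200.

Lemma run_body_leaf q S st : regs q.+1 (size S * l) st -> stacked (reals st 3) S ->
  ints st0 3 q = 0 ->
  run body_cmd st body_bound (fun st' => regs q ((size S).+1 * l) st' /\
    stacked (reals st' 3) (leaf_tail (reals st0 0 (ints st0 4 q)) :: S)).
Proof.
move=> rg sk kd; apply: run_le; first apply: run_seq; first apply: run_iset.
  set st1 := State _ _.
  have rg1 : regs q (size S * l) st1.
    case: rg => ri rr r0 r1; split=> //=; last by rewrite /upd /= r0 subn1.
    by move=> a k a6; rewrite upd_lt // ri.
  have kd1 : ints st1 3 (ints st1 6 0) = 0 by rewrite (regs_node rg1) (regs_ints rg1).
  have m1 : reals st1 = reals st by [].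
  clearbody st1; rewrite -m1 in sk.
  (* The node kind excludes the other branch, so it is charged 0. *)
  apply: (@run_if _ _ _ _ _ _ 0); last by move=> /=; rewrite kd1.
  move=> _; apply: (run_post (run_leaf rg1)) => st' [rg' wr].
  by split; [rewrite mulSn addnC|exact: stacked_wrote wr _].
by rewrite /= /body_bound; nia.
Qed.

Lemma run_body_node (c : Defs.comp) q S F1 F2 st :
  regs q.+1 ((size S).+2 * l) st -> stacked (reals st 3) [:: F1, F2 & S] ->
  ints st0 3 q = (match c with Par => 1 | Ser => 2 end) ->
  run body_cmd st body_bound (fun st' => regs q ((size S).+1 * l) st' /\
    stacked (reals st' 3)
      ((match c with Par => par_tail F1 F2 | Ser => ser_tail F1 F2 end) :: S)).
Proof.
move=> rg [/= f1 [f2 sk]] kd.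
rewrite mulSn [l + _]addnC in f1.
apply: run_le; first apply: run_seq; first apply: run_iset.
  set st1 := State _ _.
  have rg1 : regs q ((size S).+2 * l) st1.
    case: rg => ri rr r0 r1; split=> //=; last by rewrite /upd /= r0 subn1.
    by move=> a k a6; rewrite upd_lt // ri.
  have kd1 : ints st1 3 (ints st1 6 0) = match c with Par => 1 | Ser => 2 end.
    by rewrite (regs_node rg1) (regs_ints rg1).
  have m1 : reals st1 = reals st by [].
  clearbody st1; rewrite -m1 in f1 f2 sk.
  apply: (@run_if _ _ _ _ _ 0); first by move=> /=; rewrite kd1; case: (c).
  move=> _; apply: run_seq; apply: run_iset; set st2 := State _ _.
  have rg2 : regs q (size S * l + l) st2.
    have h1 := regs_height rg1; have l1 := regs_len rg1.
    case: rg1 => ri rr r0 _; split=> //=.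
      by move=> a k a6; rewrite upd_lt // ri.
    by rewrite /upd /= h1 l1 !mulSn; lia.
  have kd2 : ints st2 3 (ints st2 6 0) = match c with Par => 1 | Ser => 2 end.
    by rewrite (regs_node rg2) (regs_ints rg2).
  have m2 : reals st2 = reals st1 by [].
  clearbody st2; rewrite -m2 in f1 f2 sk.
  apply: run_if => [|]; rewrite /= kd2; case: (c) => // _.
    apply: (run_post (run_par rg2 f1 f2)) => st' [rg' wr].
    by split; [rewrite mulSn addnC|exact: stacked_wrote wr _].
  apply: (run_post (run_ser rg2 f1 f2)) => st' [rg' wr].
  by split; [rewrite mulSn addnC|exact: stacked_wrote wr _].
by rewrite /= /body_bound; nia.
Qed.

End Correctness.

Lemma size_preorder m (t : sptree m) : (size (preorder t)).+1 = (size (leaves t)).*2.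
Proof.
elim: t => //= c t1 IH1 t2 IH2; rewrite !size_cat doubleD -IH1 -IH2; lia.
Qed.

(** * Traversal of the decomposition tree and output *)

Section Program.
Variables (R : realType) (n m : nat) (G : graph n m) (p : 'I_m -> R).
Variables (s y : 'I_n) (t0 : sptree m) (l : nat).

Let st0 := input G p s y t0 l.

Lemma input_node pre x post : preorder t0 = pre ++ x :: post ->
  ints st0 3 (size pre) = x.1.1 /\ ints st0 4 (size pre) = x.1.2.
Proof.
by move=> /= ->; rewrite !map_cat !nth_cat !size_map !ltnn !subnn.
Qed.

Lemma input_prob e : reals st0 0 (nat_of_ord e) = p e.
Proof. by rewrite /= (nth_map e) ?size_enum_ord // nth_ord_enum. Qed.

(* Nodes are processed in reverse preorder, so that right subtrees come first. *)
Lemma run_tree t : forall pre post S st K Q,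
  preorder t0 = pre ++ preorder t ++ post ->
  regs st0 (size pre + size (preorder t)) (size S * l) st ->
  stacked st0 (reals st 3) S ->
  (forall st', regs st0 (size pre) ((size S).+1 * l) st' ->
     stacked st0 (reals st' 3) (tail p t :: S) -> run loop_cmd st' K Q) ->
  run loop_cmd st (size (preorder t) * (4 + body_bound st0) + K) Q.
Proof.
elim: t => [e b|c t1 IH1 t2 IH2] pre post S st K Q /= E rg sk next.
  rewrite mul1n; rewrite addn1 in rg.
  have [kd ed] := input_node E; rewrite /= in kd ed.
  apply: run_while_step; first by rewrite /= (regs_node rg).
  apply: (run_post (run_body_leaf rg sk kd)) => st' [rg' sk'].
  apply: next => //; move: sk'; by rewrite [ints st0 4 _]ed input_prob.
pose pre1 := rcons pre (match c with Par => 1 | Ser => 2 end, 0, 0).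
have E1 : preorder t0 = pre1 ++ preorder t1 ++ preorder t2 ++ post.
  by rewrite E cat_rcons catA.
have E2 : preorder t0 = (pre1 ++ preorder t1) ++ preorder t2 ++ post.
  by rewrite E1 !catA.
have [kd _] := input_node E; rewrite /= in kd.
(* The 4 is the cost of the loop test. *)
pose N := 4 + body_bound st0.
(* The budget is regrouped in order of execution: right subtree, left subtree, root,
   continuation. *)
have -> : (size (preorder t1 ++ preorder t2)).+1 * N + K =
    size (preorder t2) * N + (size (preorder t1) * N + (N + K)).
  by rewrite size_cat; nia.
apply: (IH2 _ _ S _ _ _ E2) => //.
  by move: rg; rewrite !size_cat size_rcons addSn addnS addnA.
move=> st2 rg2 sk2; apply: (IH1 _ _ (tail p t2 :: S) _ _ _ E1) => //.
  by move: rg2; rewrite size_cat.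
move=> st1; rewrite size_rcons => rg1 sk1.
apply: run_while_step; first by rewrite /= (regs_node rg1).
apply: (run_post (run_body_node rg1 sk1 kd)) => st' [rg' sk'].
by apply: next => //; move: sk'; case: (c).
Qed.

Lemma run_output F st q b : regs st0 q b st ->
  (forall k, k < l -> reals st 3 k = F k) ->
  run output_cmd st (60 * l + 60) (fun st' =>
    (forall i, 1 <= i <= l -> out_ge st' i = F i.-1) /\
    (forall i, 1 <= i <= l.-1 -> out_eq st' i = (F i.-1 - F i)%R)).
Proof.
move=> rg f.
pose Inv i st' := [/\ regs st0 q b st', ints st' 6 2 = i, reals st' 3 =1 reals st 3,
  forall k, 1 <= k <= i -> reals st' 1 k = F k.-1 &
  forall k, 1 <= k < i -> reals st' 2 k = (F k.-1 - F k)%R].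
apply: run_le; first apply: run_seq; first apply: run_iset.
  apply: (@run_post _ _ _ _ _ (Inv l)); first apply: (@run_for _ _ _ Inv).
  - move=> i st1 il [rg1 r2 mem ge eq]; split.
      by rewrite /= r2 (regs_len rg1) addn1.
    apply: run_seq; apply: run_rset; apply: run_seq; apply: run_rset; apply: run_iset.
    split.
    + by apply: regs_iset => //; apply: regs_rset => //; apply: regs_rset.
    + by rewrite /= /upd /= r2 addn1.
    + by move=> x; rewrite /= /upd /= mem.
    + move=> k ki; rewrite /= /upd /= r2 mem f //.
      have [->|ne] := eqVneq k (i + 1); first by rewrite addn1.
      by apply: ge; lia.
    + move=> k ki; rewrite /= /upd /= r2 !mem !f //; last by lia.
      have [->|ne] := eqVneq k i; first by rewrite subn1.
      by apply: eq; lia.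
  - by move=> st1 [rg1 r2 _ _ _]; rewrite /= r2 (regs_len rg1) /=; lia.
  - split; [exact: regs_iset|by []|by []| |]; by move=> k; lia.
  move=> st' [_ _ _ ge eq]; split=> i il; first exact: ge.
  by apply: eq; lia.
by rewrite /=; lia.
Qed.

Lemma run_program : perm_eq (leaves t0) (enum 'I_m) ->
  run sp_program st0 ((m + m).-1 * (4 + body_bound st0) + 60 * l + 100) (fun st' =>
    (forall i, 1 <= i <= l -> out_ge st' i = tail p t0 i.-1) /\
    (forall i, 1 <= i <= l.-1 -> out_eq st' i = (tail p t0 i.-1 - tail p t0 i)%R)).
Proof.
move=> pl; have szl : size (leaves t0) = m by rewrite (perm_size pl) size_enum_ord.
have sz : size (preorder t0) = (m + m).-1.
  by have := size_preorder t0; rewrite szl; lia.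
apply: run_le; first apply: run_seq; first apply: run_iset; first apply: run_seq.
  set st1 := State _ _.
  (* After the whole tree only the failing loop test remains, at cost 4. *)
  apply: (@run_tree t0 [::] [::] [::] st1 4); first by rewrite cats0.
  - split=> //=; first by move=> a k a6; rewrite upd_lt.
    by rewrite /upd /= sz subn1.
  - by [].
  - move=> st' rg' [/= f _].
    apply: run_while_end; first by rewrite /= (regs_node rg').
    by apply: (run_output rg') => k /f; rewrite mul0n.
by rewrite sz /=; lia.
Qed.

End Program.

(** * Minimum arrival time *)

Section MinArrival.
Variables (R : realType) (n m : nat) (G : graph n m) (snap : nat -> {set 'I_m}).
Variables (s y : 'I_n) (t : sptree m).
Hypothesis D : decomposition_tree G s y t.

Let reach_by := reach t (fun et => et.1 \in snap et.2) 0.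

(** Arrival times are integers, so a lower bound [i.+1] excludes exactly those up to [i]. An infimum
    of +oo is covered as well. *)
Lemma min_arrival_ge i :
  (((i.+1)%:R)%:E <= min_arrival R G snap s y)%E = ~~ reach_by i.
Proof.
apply/idP/negP => [le /(arrival_reach _ _ D)[a aX ai]|nr].
  have := le_trans le (ereal_inf_lbound (ex_intro2 _ _ a aX erefl)).
  by rewrite lee_fin ler_nat ltnNge ai.
apply: le_ereal_inf_tmp => _ [a aX <-]; rewrite lee_fin ler_nat ltnNge.
by apply/negP => ai; apply: nr; apply/(arrival_reach _ _ D); exists a.
Qed.

(** [min_arrival_ge] gives the lower bound; an actual arrival by [i.+1] gives the upper one. *)
Lemma min_arrival_eq i :
  min_arrival R G snap s y = ((i.+1)%:R)%:E <-> ~~ reach_by i && reach_by i.+1.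
Proof.
rewrite -[reach_by i.+1]negbK -!min_arrival_ge; split.
  by move=> ->; rewrite !lee_fin !ler_nat leqnn ltnn.
rewrite !min_arrival_ge negbK => /andP[nr /(arrival_reach _ _ D)[a aX ai]].
apply/le_anti/andP; split; last by rewrite min_arrival_ge.
apply: (@le_trans _ _ (a%:R)%:E); last by rewrite lee_fin ler_nat.
exact: ereal_inf_lbound (ex_intro2 _ _ a aX erefl).
Qed.

End MinArrival.

(** * The algorithm, its running time and its correctness *)

Theorem theorem5 :
  exists (prog : cmd) (C : nat),
  forall (R : realType) (n m : nat) (G : graph n m) (p : 'I_m -> R)
    (d : measure_display) (T : measurableType d) (P : probability T R)
    (snap : nat -> T -> {set 'I_m}) (s y : 'I_n) (t : sptree m) (l : nat),
  memoryless P p snap ->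
  series_parallel G (whole G s y) ->
  decomposition_tree G s y t ->
  let X := fun w : T => min_arrival R G (fun k => snap k w) s y in
  exists (st : state R) (k : nat),
    [/\ exec prog (input G p s y t l) k st,
        0 < l -> k <= C * (m * l ^ 2),
        forall i, 1 <= i <= l ->
          P [set w | ((i%:R)%:E <= X w)%E] = (out_ge st i)%:E &
        forall i, 1 <= i <= l.-1 ->
          P [set w | X w = (i%:R)%:E] = (out_eq st i)%:E].
Proof.
exists sp_program, 3000 => R n m G p d T P snap s y t l ml _ D X.
have pl := decomposition_tree_leaves D.
have ut : uniq (leaves t) by rewrite (perm_uniq pl) enum_uniq.
have [k [st [ex le [ge eq]]]] := run_program G p s y l pl.
(* A tree has at least one leaf; with [0 < l], the lower-order terms are then absorbed by
   [m * l ^ 2]. *)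
have m0 : 0 < m by have := size_preorder t; rewrite (perm_size pl) size_enum_ord; lia.
exists st, k; split=> //.
- move=> l0; apply: (leq_trans le); rewrite /body_bound /=; nia.
- case=> [//|i] il; rewrite ge //= -(pr_reached ml 0 i ut) add0n -prE; last first.
    exact: eventN (event_reached ml _ _ _).
  by congr (P _); apply/seteqP; split=> w; rewrite /= (min_arrival_ge R _ D).
- case=> [//|i] il; rewrite eq //= -(pr_reached ml 0 i ut) -(pr_reached ml 0 i.+1 ut).
  rewrite !add0n.
  (* The event X > i+1 is contained in X > i, so the difference of the tails is the probability of X
     = i+1. *)
  have mono : (fun w => ~~ reached snap t 0 i.+1 w) =1
    (fun w => ~~ reached snap t 0 i w && ~~ reached snap t 0 i.+1 w).
    move=> w; case r: (reached snap t 0 i w) => //=; apply/negbF.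
    by apply: reach_mono r.
  have mi := event_reached ml t 0 i; have mi1 := event_reached ml t 0 i.+1.
  rewrite (pr_split P (eventN mi) (eventN mi1)) -(eq_pr P mono) addrC addKr -prE; last first.
    by apply: eventI; do ?[apply: eventN].
  congr (P _); apply/seteqP.
  by split=> w /=; rewrite negbK; have [] := min_arrival_eq R (snap^~ w) D i.
Qed.
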